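(* Let $P$ be a connected link diagram in the plane, let $\langle P\rangle\in\mathbb{Z}[A,A^{-1}]$ be its Kauffman bracket, and let $\mathbb{D}:=\mathbb{D}(A)$ be the oriented ribbon graph of $P$ associated to the all-$A$-splicing. Fix a total order $\prec$ on the edges of $\mathbb{D}$. Then the Kauffman bracket can be computed by the following spanning tree expansion: $$A^{-e(\mathbb{D})}\langle P\rangle = A^{2-2v(\mathbb{D})}\sum_T X^{i(T)}\sum_{S\subset\mathcal{E}(T)}Y^{n(T\cup S)}Z^{g(T\cup S)}$$ under the specialization $X\mapsto -A^4$, $Y\mapsto A^{-2}\delta$, $Z\mapsto\delta^{-2}$, where $\delta:=-A^2-A^{-2}$. Here $T$ runs over all spanning trees of $\mathbb{D}$, $i(T)$ is the number of internally active edges of $T$, and $\mathcal{E}(T)$ is the set of externally active edges for $T$, both with respect to $\prec$.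
   Context: Oriented ribbon graphs. A connected oriented ribbon graph is a triple $\mathbb{D}=(\sigma_0,\sigma_1,\sigma_2)$ of permutations of a finite set $\mathcal{B}$ with $2n$ elements (half-edges) such that $\sigma_1$ is a fixed-point-free involution, $\sigma_0(\sigma_1(\sigma_2(b)))=b$ for all $b$, and $\langle\sigma_0,\sigma_1\rangle$ acts transitively on $\mathcal{B}$. The empty set of half-edges is also allowed; that ribbon graph has one vertex, no edges and one face. An oriented ribbon graph is a disjoint union of connected ones. Vertices, edges, faces are the orbits of $\sigma_0,\sigma_1,\sigma_2$ respectively (each component without half-edges contributes one vertex and one face); an edge joins the vertices containing its two half-edges. Write $v,e,f,k$ for the numbers of vertices, edges, faces, connected components; the genus is $g(\mathbb{D})=\frac{2k(\mathbb{D})-v(\mathbb{D})+e(\mathbb{D})-f(\mathbb{D})}{2}$ and the nullity is $n(\mathbb{D})=e(\mathbb{D})-v(\mathbb{D})+k(\mathbb{D})$. Subgraphs on the same vertex set are obtained by deleting edges, i.e. omitting their half-edges from the cyclic orders at the vertices (keeping all vertices); they are again oriented ribbon graphs. Activities. A spanning tree $T$ of $\mathbb{D}$ is a connected subgraph with the same vertex set and no cycles. For an edge $e$ of $T$, the cut determined by $e$ and $T$ is the set of edges of $\mathbb{D}$ connecting one component of $T-e$ to the other; $e$ is internally active if it is the smallest element of this cut in the order $\prec$. An edge $e$ not in $T$ is externally active if it is the smallest element in the unique cycle in $T\cup e$. Link diagrams. A diagram is connected if its underlying planar 4-valent graph (with crossings as vertices, or a single circle if there are no crossings) is connected. At a crossing,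 the $A$-splicing is the smoothing that joins the two local regions swept out by rotating the over-strand counterclockwise until it meets the under-strand; the $B$-splicing is the other smoothing. The Kauffman bracket is determined by $\langle\bigcirc\rangle=1$, $\langle L\sqcup\bigcirc\rangle=\delta\langle L\rangle$ with $\delta=-A^2-A^{-2}$, and $\langle L\rangle=A\langle L_A\rangle+A^{-1}\langle L_B\rangle$, where $L_A,L_B$ are the results of $A$- and $B$-splicing a chosen crossing. Ribbon graph of the all-$A$-splicing. Perform the $A$-splicing at every crossing, obtaining disjoint circles in the plane together with, for each crossing, an embedded arc joining the two spliced strands. Orient each circle clockwise or anticlockwise according to whether it lies inside an odd or even number of the other circles. The half-edges are pairs $(C,\gamma)$ where $C$ is a circle and $\gamma$ is a directed splicing arc starting on $C$. The permutation $\sigma_0$ sends a half-edge to the next one met along $C$ in the direction of its orientation, $\sigma_1$ sends a directed arc to the oppositely directed arc, and $\sigma_2$ is determined by $\sigma_0\sigma_1\sigma_2=1$. Thus vertices are the circles and edges are the crossings. *)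

(* Defs.v *)
From mathcomp Require Import all_boot all_fingroup all_algebra.

Set Implicit Arguments.
Unset Strict Implicit.
Unset Printing Implicit Defensive.

Import GRing.Theory.

Section Permutations.
Variable T : finType.
Implicit Types (s t : {perm T}) (B : {set T}).

Lemma porbit_eq_on s t x :
  {in porbit s x, s =1 t} -> porbit t x = porbit s x.
Proof.
move=> st.
have E i : (t ^+ i)%g x = (s ^+ i)%g x.
  elim: i => [|i IH]; first by rewrite !expg0 !perm1.
  by rewrite !expgSr !permM IH st // mem_porbit.
by apply/setP=> y; apply/porbitP/porbitP => -[i ->]; exists i; rewrite E.
Qed.

Lemma porbit1 s x : porbit s (s x) = porbit s x.
Proof. exact: (porbit_perm s 1 x). Qed.

Lemma porbit_stable s B : {in B, forall x, s x \in B} ->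
  forall x y, y \in porbit s x -> (x \in B) = (y \in B).
Proof.
move=> sB x y xy.
have H a b : b \in porbit s a -> a \in B -> b \in B.
  move=> /porbitP[i ->]; elim: i => [|i IH] aB; first by rewrite expg0 perm1.
  by rewrite expgSr permM sB // IH.
by apply/idP/idP; apply: H => //; rewrite porbit_sym.
Qed.

Lemma card_porbit2 s x : s x != x -> s (s x) = x -> #|porbit s x| = 2.
Proof.
move=> sx ssx; have -> : porbit s x = [set x; s x]; last first.
  by rewrite cards2 eq_sym sx.
have st : {in [set x; s x], forall y, s y \in [set x; s x]}.
  by move=> y; rewrite !inE => /orP[]/eqP->; rewrite ?ssx eqxx ?orbT.
apply/setP=> y; apply/idP/idP.
  by move=> xy; rewrite -(porbit_stable st xy) !inE eqxx.
by rewrite !inE => /orP[]/eqP->; rewrite ?porbit_id // -eq_porbit_mem porbit1.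
Qed.

Lemma porbit2K s x : #|porbit s x| = 2 -> s (s x) = x.
Proof. by move=> c2; have := iter_porbit s x; rewrite c2. Qed.

Lemma porbit2_neq s x : #|porbit s x| = 2 -> s x != x.
Proof.
move=> c2; apply/eqP => sx.
have : porbit s x \subset [set x].
  apply/subsetP=> y /porbitP[i ->]; rewrite inE.
  by elim: i => [|i]; rewrite ?expg0 ?perm1 // expgSr permM => /eqP->; rewrite sx.
by move=> /subset_leq_card; rewrite cards1 c2.
Qed.

(* The first return map of [s] to [B]: [x \in B] goes to the first of
   s x, s (s x), ... that lies in [B]; points outside [B] are fixed. *)
Definition return_fun s B x :=
  if x \in B then iter (find (mem B) (traject s (s x) #|T|)).+1 s x else x.

Lemma return_funP s B x : x \in B -> exists2 k, return_fun s B x = iter k.+1 s x &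
  iter k.+1 s x \in B /\ forall j, 0 < j -> j <= k -> iter j s x \notin B.
Proof.
move=> xB; rewrite /return_fun xB.
set l := traject _ _ _; exists (find (mem B) l) => //.
have hl : has (mem B) l.
  apply/hasP; exists x => //; apply/trajectP.
  exists (#|porbit s x|).-1.
    by rewrite prednK ?card_porbit_neq0 ?max_card // lt0n card_porbit_neq0.
  by rewrite -iterSr prednK ?iter_porbit // lt0n card_porbit_neq0.
have fl : find (mem B) l < #|T| by rewrite has_find size_traject in hl.
split.
  by have := nth_find (s x) hl; rewrite nth_traject //= -iterSr.
case=> // j _ jk; have := before_find (s x) jk; rewrite /l nth_traject; last exact: ltn_trans jk fl.
by rewrite -iterSr /= => ->.
Qed.

Lemma return_fun_in s B x : (return_fun s B x \in B) = (x \in B).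
Proof.
case xB: (x \in B); last by rewrite /return_fun xB xB.
by have [k -> []] := return_funP s xB.
Qed.

Lemma return_fun_inj s B : injective (return_fun s B).
Proof.
have W x y i j : x \in B -> i <= j -> iter i.+1 s x = iter j.+1 s y ->
    (forall l, 0 < l -> l <= j -> iter l s y \notin B) -> x = y.
  move=> xB ij E m.
  have E2 : x = iter (j - i) s y.
    apply: (@perm_inj _ (s ^+ i.+1)%g); rewrite !permX E -iterD.
    by rewrite addSn subnKC.
  case: (posnP (j - i)) => [d0|d0]; first by rewrite E2 d0.
  by have := m _ d0 (leq_subr _ _); rewrite -E2 xB.
move=> x y e; have := return_fun_in s B x; rewrite e return_fun_in.
case yB: (y \in B) => xB; last by move: e; rewrite /return_fun yB -xB.
have {}xB := esym xB; move: e.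
have [i -> [_ mi]] := return_funP s xB; have [j -> [_ mj]] := return_funP s yB.
move=> e; case/orP: (leq_total i j) => ij; first exact: W xB ij e mj.
exact/esym/(W _ _ _ _ yB ij (esym e) mi).
Qed.

Definition return_perm s B : {perm T} := perm (@return_fun_inj s B).

End Permutations.

(* A link diagram is an embedded graph whose vertices are its crossings (of
   valency 4) and finitely many ordinary points of its arcs (of valency 2);
   the latter allow for circles without crossings.  A dart is an edge of this
   graph with a direction, and it belongs to the vertex from which it leaves:
   [turn x] is the next dart counterclockwise around that vertex, [flip x] is
   the reversed dart.  [over] matters only at crossings, where it holds the two
   darts of the over-strand.  That the surface is a sphere is stated by
   [planar] below. *)
Definition diagram_axiom (T : finType) (X : {set T}) (turn flip : {perm T})
    (over : {set T}) : Prop :=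
  [/\ {in X, forall x, turn x \in X /\ flip x \in X},
      {in X, forall x, flip (flip x) = x},
      {in X, forall x, flip x != x},
      {in X, forall x, #|porbit turn x| = 2 \/ #|porbit turn x| = 4} &
      {in X, forall x, #|porbit turn x| = 4 ->
                       (turn x \in over) = (x \notin over)}].

Record diagram (T : finType) := Diagram {
  darts : {set T};
  turn : {perm T};
  flip : {perm T};
  over : {set T};
  diagramP : diagram_axiom darts turn flip over
}.

Section Diagrams.
Variable T : finType.
Implicit Types (D : diagram T) (b : bool) (x y o : T) (C : {set T}).

Definition crossing D x := (x \in darts D) && (#|porbit (turn D) x| == 4).

Definition component D x : {set T} :=
  [set y | connect [rel u v | (v == turn D u) || (v == flip D u)] x y].

Definition connected_diagram D : Prop :=
  darts D != set0 /\ {in darts D &, forall x y, y \in component D x}.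

(* The orbit of [x] under [face D] is the boundary of the face to the left
   of [x]. *)
Definition face D : {perm T} := (flip D * (turn D)^-1)%g.

(* Euler's formula; meant for connected diagrams.  A plane diagram is a planar
   one together with a choice of the unbounded face. *)
Definition planar D : Prop :=
  #|[set porbit (turn D) x | x in darts D]|
    + #|[set porbit (face D) x | x in darts D]|
  = #|[set porbit (flip D) x | x in darts D]| + 2.

(* [join true] and [join false] connect the four darts at each crossing in
   pairs, as the A- and the B-splicing do.  An over-strand dart [x] that
   rotates counterclockwise sweeps the corner between [x] and [turn D x]; the
   A-splicing opens this corner, so that it connects [turn D x] with
   [turn D (turn D x)].  At the ordinary points both agree with [turn D]. *)
Definition join_fun b D x :=
  if crossing D x && ((x \in over D) == b) then (turn D)^-1%g x else turn D x.

Lemma crossing_turn D x : crossing D (turn D x) = crossing D x.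
Proof.
have [h _ _ _ _] := diagramP D.
have st : {in darts D, forall x, turn D x \in darts D} by move=> z /h[].
have xt : turn D x \in porbit (turn D) x by rewrite -eq_porbit_mem porbit1.
by rewrite /crossing -(porbit_stable st xt) porbit1.
Qed.

Lemma crossing_turnV D x : crossing D ((turn D)^-1%g x) = crossing D x.
Proof. by rewrite -crossing_turn permKV. Qed.

Lemma over_turn D x : crossing D x -> (turn D x \in over D) = (x \notin over D).
Proof. by case/andP=> xD /eqP x4; have [_ _ _ _ ->] := diagramP D. Qed.

Lemma over_turnV D x : crossing D x ->
  ((turn D)^-1%g x \in over D) = (x \notin over D).
Proof.
move=> cx; have := @over_turn D ((turn D)^-1%g x).
by rewrite crossing_turnV permKV => /(_ cx) ->; rewrite negbK.
Qed.

Lemma crossing_join b D x : crossing D (join_fun b D x) = crossing D x.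
Proof. by rewrite /join_fun; case: ifP => _; rewrite ?crossing_turn ?crossing_turnV. Qed.

Lemma join_funK b D x : crossing D x -> join_fun b D (join_fun b D x) = x.
Proof.
move=> cx; rewrite {1}/join_fun crossing_join cx /= /join_fun cx /=.
have [xb|xb] := eqVneq (x \in over D) b.
  by rewrite over_turnV // xb; case: b {xb} => /=; rewrite permKV.
by rewrite over_turn // -addbT (_ : (_ (+) true) = b) ?eqxx ?permK //;
  case: (x \in _) b xb => [] [].
Qed.

Lemma join_fun_inj b D : injective (join_fun b D).
Proof.
move=> x y e; have := crossing_join b D x; rewrite e crossing_join.
case cy: (crossing D y) => cx.
  by rewrite -(@join_funK b D x) -?cx // e join_funK.
by move: e; rewrite /join_fun cy -cx => /perm_inj.
Qed.

Definition join b D : {perm T} := perm (@join_fun_inj b D).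

Definition splice_fun b D x0 x :=
  if x \in porbit (turn D) x0 then join b D x else turn D x.

Lemma turn_porbit D x0 x :
  (turn D x \in porbit (turn D) x0) = (x \in porbit (turn D) x0).
Proof. by rewrite -!eq_porbit_mem porbit1. Qed.

Lemma turnV_porbit D x0 x :
  ((turn D)^-1%g x \in porbit (turn D) x0) = (x \in porbit (turn D) x0).
Proof. by rewrite -turn_porbit permKV. Qed.

Lemma join_porbit b D x0 x :
  (join b D x \in porbit (turn D) x0) = (x \in porbit (turn D) x0).
Proof. by rewrite permE /join_fun; case: ifP; rewrite ?turn_porbit ?turnV_porbit. Qed.

Lemma splice_fun_porbit b D x0 x :
  (splice_fun b D x0 x \in porbit (turn D) x0) = (x \in porbit (turn D) x0).
Proof.
by rewrite /splice_fun; case: ifP => h; rewrite ?join_porbit ?turn_porbit h.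
Qed.

Lemma splice_fun_inj b D x0 : injective (splice_fun b D x0).
Proof.
move=> x y e; have := splice_fun_porbit b D x0 x; rewrite e splice_fun_porbit.
by move: e; rewrite /splice_fun => + h; rewrite -h; case: ifP => _ /perm_inj.
Qed.

Definition splice_turn b D x0 : {perm T} := perm (@splice_fun_inj b D x0).

Lemma turn_darts D x : (turn D x \in darts D) = (x \in darts D).
Proof.
have [h _ _ _ _] := diagramP D.
have st : {in darts D, forall x, turn D x \in darts D} by move=> z /h[].
by rewrite (@porbit_stable _ _ _ st x (turn D x)) // -eq_porbit_mem porbit1.
Qed.

Lemma turnV_darts D x : ((turn D)^-1%g x \in darts D) = (x \in darts D).
Proof. by rewrite -turn_darts permKV. Qed.

Lemma flip_darts D x : (flip D x \in darts D) = (x \in darts D).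
Proof.
have [h _ _ _ _] := diagramP D.
have st : {in darts D, forall x, flip D x \in darts D} by move=> z /h[].
by rewrite (@porbit_stable _ _ _ st x (flip D x)) // -eq_porbit_mem porbit1.
Qed.

Lemma join_darts b D x : (join b D x \in darts D) = (x \in darts D).
Proof. by rewrite permE /join_fun; case: ifP; rewrite ?turn_darts ?turnV_darts. Qed.

Lemma joinK b D x : x \in darts D -> join b D (join b D x) = x.
Proof.
move=> xD; case cx: (crossing D x); first by rewrite !permE join_funK.
rewrite !permE {1}/join_fun crossing_join cx /= /join_fun cx /=.
apply: porbit2K; have [_ _ _ /(_ _ xD)[//|x4] _] := diagramP D.
by move: cx; rewrite /crossing xD x4.
Qed.

Lemma over_join b D x : crossing D x -> (join b D x \in over D) = (x \notin over D).
Proof.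
move=> cx; rewrite permE /join_fun cx /=.
by case: ifP => _; rewrite ?(over_turn cx) ?(over_turnV cx).
Qed.

Lemma join_neq b D x : x \in darts D -> join b D x != x.
Proof.
move=> xD; case cx: (crossing D x).
  apply/eqP; rewrite permE /join_fun cx /=; case: ifP => _ e.
    by have := over_turnV cx; rewrite e; case: (_ \in _).
  by have := over_turn cx; rewrite e; case: (_ \in _).
rewrite permE /join_fun cx /=.
apply: porbit2_neq; have [_ _ _ /(_ _ xD)[//|x4] _] := diagramP D.
by move: cx; rewrite /crossing xD x4.
Qed.

Lemma splice_turn_off b D x0 x : x \notin porbit (turn D) x0 ->
  porbit (splice_turn b D x0) x = porbit (turn D) x.
Proof.
move=> nx; apply: porbit_eq_on => y xy.
rewrite permE /splice_fun ifF //; apply: contraNF nx => y0.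
by move: y0; rewrite -!eq_porbit_mem => /eqP <-; rewrite eq_porbit_mem porbit_sym.
Qed.

Lemma splice_turn_on b D x0 x : x \in darts D -> x \in porbit (turn D) x0 ->
  #|porbit (splice_turn b D x0) x| = 2.
Proof.
move=> xD nx; have ex : splice_turn b D x0 x = join b D x.
  by rewrite permE /splice_fun nx.
apply: card_porbit2; first by rewrite ex join_neq.
by rewrite ex permE /splice_fun join_porbit nx joinK.
Qed.

Lemma splice_subproof b D x0 :
  diagram_axiom (darts D) (splice_turn b D x0) (flip D) (over D).
Proof.
have [h1 h2 h3 h4 h5] := diagramP D; split=> // x xD.
- split; last by case: (h1 x xD).
  by rewrite permE /splice_fun; case: ifP; rewrite ?join_darts ?turn_darts.
- case nx: (x \in porbit (turn D) x0); first by left; apply: splice_turn_on.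
  by rewrite splice_turn_off ?nx //; apply: h4.
- case nx: (x \in porbit (turn D) x0); first by rewrite splice_turn_on.
  by rewrite splice_turn_off ?nx // => x4; rewrite permE /splice_fun nx h5.
Qed.

(* The A-splicing ([b = true]) or the B-splicing of the crossing of [x0],
   which becomes two ordinary points. *)
Definition splice b D x0 : diagram T := Diagram (splice_subproof b D x0).

Lemma crossing_splice b D x0 x : crossing (splice b D x0) x =
  crossing D x && (x \notin porbit (turn D) x0).
Proof.
rewrite /crossing /=; case xD: (x \in darts D) => //=.
case nx: (x \in porbit (turn D) x0); first by rewrite splice_turn_on ?andbF.
by rewrite splice_turn_off ?nx ?andbT.
Qed.

Lemma component_sym D x y : (y \in component D x) = (x \in component D y).
Proof.
rewrite !inE; set e := (X in connect X).
have step u v : e u v -> connect e v u.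
  have st (s : {perm T}) w : subrel (frel s) e -> connect e (s w) w.
    move=> se; have : fconnect s (s w) w by rewrite fconnect_sym ?fconnect1 //; apply: perm_inj.
    by apply: connect_sub => p q /se; apply: connect1.
  by case/orP=> /eqP ->; apply: st => p q /eqP <-; rewrite /e /= eqxx ?orbT.
have cs u v : connect e u v -> connect e v u.
  move/connectP=> [p]; elim: p u => [|w p IH] u /=; first by move=> _ ->.
  by case/andP=> /step wu ep ev; apply: connect_trans (IH _ ep ev) wu.
by apply/idP/idP; apply: cs.
Qed.

Lemma component_stable D x y :
  y \in component D x -> turn D y \in component D x /\ flip D y \in component D x.
Proof.
by rewrite !inE => xy; split; apply: connect_trans xy (connect1 _); rewrite /= eqxx ?orbT.
Qed.

Lemma remove_subproof D x :
  diagram_axiom (darts D :\: component D x) (turn D) (flip D) (over D).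
Proof.
have [h1 h2 h3 h4 h5] := diagramP D.
split=> y /setDP[yD yx]; [|exact: h2|exact: h3|exact: h4|exact: h5].
have [ty fy] := h1 _ yD; rewrite !in_setD ty fy !andbT.
have S z : y \in component D z -> z \notin component D x.
  move=> yz; apply: contra yx; rewrite !inE in yz * => xz; exact: connect_trans yz.
split; apply: S; rewrite component_sym.
  by have [] := @component_stable D y y; rewrite // inE connect0.
by have [] := @component_stable D y y; rewrite // inE connect0.
Qed.

Definition remove_component D x : diagram T := Diagram (remove_subproof D x).

Definition crossingless D (C : {set T}) := [forall y in C, ~~ crossing D y].

Local Open Scope ring_scope.

(* The field Q(A), which contains Z[A, A^-1]. *)
Definition ratfun : fieldType := {fraction {poly int}}.
Definition A : ratfun := tofrac ('X : {poly int}).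
Definition delta : ratfun := - A ^+ 2 - A ^- 2.

(* [kauffman D p]: the rules of the Kauffman bracket yield the value [p]
   for [D].  In [Kauffman_disjoint_circle], [D] is the disjoint union of
   [remove_component D x] and a circle; the empty diagram has no value. *)
Inductive kauffman : diagram T -> ratfun -> Prop :=
| Kauffman_circle D x :
    x \in darts D -> darts D = component D x ->
    crossingless D (component D x) ->
    kauffman D 1
| Kauffman_disjoint_circle D x p :
    x \in darts D -> crossingless D (component D x) ->
    kauffman (remove_component D x) p ->
    kauffman D (delta * p)
| Kauffman_splice D x p q :
    crossing D x ->
    kauffman (splice true D x) p -> kauffman (splice false D x) q ->
    kauffman D (A * p + A^-1 * q).

Lemma kauffman_total D : darts D != set0 -> exists p, kauffman D p.
Proof.
have [n le_n] := ubnP (#|[set x | crossing D x]| + #|darts D|)%N.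
elim: n D le_n => // n IH D le_n D0.
case: (pickP (crossing D)) => [x cx | nc].
  have H b : exists p, kauffman (splice b D x) p.
    apply: IH => //; rewrite ltnS in le_n; apply: leq_trans le_n.
    rewrite ltn_add2r; apply: proper_card; apply/properP; split.
      by apply/subsetP=> y; rewrite !inE crossing_splice => /andP[].
    by exists x; rewrite !inE // crossing_splice porbit_id andbF.
  have [[p Hp] [q Hq]] := (H true, H false).
  by exists (A * p + A^-1 * q); apply: Kauffman_splice cx Hp Hq.
have [x xD] := set0Pn _ D0.
have cl : crossingless D (component D x) by apply/forall_inP=> y _; rewrite nc.
have [R0|R0] := eqVneq (darts (remove_component D x)) set0.
  exists 1; apply: (Kauffman_circle xD _ cl).
  apply/eqP; rewrite eqEsubset -setD_eq0 (eqP (_ : _ :\: _ == set0)) ?eqxx /=; last first.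
    exact/eqP.
  apply/subsetP=> y; rewrite inE.
  move=> /connectP[p + ->]; elim: p x xD {cl R0} => //= z p IHp x xD /andP[xz].
  by apply: IHp; case/orP: xz => /eqP ->; rewrite ?turn_darts ?flip_darts.
have [|p Hp] := IH (remove_component D x) _ R0; last first.
  by exists (delta * p); apply: Kauffman_disjoint_circle Hp.
rewrite ltnS in le_n; apply: leq_trans le_n; rewrite -addnS leq_add //.
  apply: subset_leq_card; apply/subsetP=> y; rewrite !inE /crossing /=.
  by rewrite inE => /andP[/andP[_ ->]].
apply: proper_card; apply/properP; split; first exact: subsetDl.
by exists x; rewrite // !inE connect0.
Qed.

End Diagrams.

(* An oriented ribbon graph with half-edge set [halves], given by sigma_0 and
   sigma_1 ([s2] below is determined by sigma_0 sigma_1 sigma_2 = 1), together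
   with [isolated] components that have no half-edges.  The values of the
   permutations outside [halves] are irrelevant. *)
Record ribbon_graph (T : finType) := RibbonGraph {
  halves : {set T};
  s0 : {perm T};
  s1 : {perm T};
  isolated : nat;
  ribbonP : {in halves, forall b,
    [/\ s0 b \in halves, s1 b \in halves, s1 (s1 b) = b & s1 b != b]}
}.

Section RibbonGraphs.
Variable T : finType.
Implicit Types (D : ribbon_graph T) (F : {set {set T}}) (le : rel {set T}).

Definition s2 D : {perm T} := (s1 D * s0 D)^-1%g.

Lemma s012 D b : s0 D (s1 D (s2 D b)) = b.
Proof. by rewrite -permM permKV. Qed.

Definition vertex D b : {set T} := porbit (s0 D) b.
Definition edge D b : {set T} := porbit (s1 D) b.
Definition edges D : {set {set T}} := [set edge D b | b in halves D].

Definition ribbon_component D b : {set T} :=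
  [set c | connect [rel x y | (y == s0 D x) || (y == s1 D x)] b c].

Definition nv D : nat := #|[set vertex D b | b in halves D]| + isolated D.
Definition ne D : nat := #|edges D|.
Definition nf D : nat := #|[set porbit (s2 D) b | b in halves D]| + isolated D.
Definition nk D : nat :=
  #|[set ribbon_component D b | b in halves D]| + isolated D.

(* The division by 2 is exact. *)
Definition genus D : int :=
  ((2 * (nk D)%:Z - (nv D)%:Z + (ne D)%:Z - (nf D)%:Z)%R %/ 2)%Z.
Definition nullity D : int := ((ne D)%:Z - (nv D)%:Z + (nk D)%:Z)%R.

Definition sub_halves D F : {set T} := [set b in halves D | edge D b \in F].

Lemma edge_s1 D b : edge D (s1 D b) = edge D b.
Proof. exact: porbit1. Qed.

Lemma subgraph_subproof D F : {in sub_halves D F, forall b,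
  [/\ return_perm (s0 D) (sub_halves D F) b \in sub_halves D F,
      s1 D b \in sub_halves D F, s1 D (s1 D b) = b & s1 D b != b]}.
Proof.
move=> b bF; rewrite permE return_fun_in bF.
move: bF; rewrite !inE edge_s1 => /andP[/(@ribbonP _ D)[_ -> -> ->] ->].
by [].
Qed.

(* The subgraph with all the vertices of [D] and edge set [F]. *)
Definition subgraph D F : ribbon_graph T := @RibbonGraph T
  (sub_halves D F) (return_perm (s0 D) (sub_halves D F)) (s1 D)
  (isolated D
   + #|[set V in [set vertex D b | b in halves D] | [disjoint V & sub_halves D F]]|)
  (@subgraph_subproof D F).

(* [c] lists half-edges, one of each edge along the cycle. *)
Definition is_cycle D (c : seq T) :=
  [&& c != [::], all (mem (halves D)) c,
      path.cycle [rel b c | vertex D (s1 D b) == vertex D c] c,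
      uniq (map (vertex D) c) & uniq (map (edge D) c)].

(* The edge sets of all cycles; a cycle has at most #|T| edges. *)
Definition cycles D : {set {set {set T}}} :=
  [set [set edge D b | b in c] | c : {bseq #|T| of T} & is_cycle D c].

Definition spanning_trees D : {set {set {set T}}} :=
  [set F : {set {set T}} | [&& F \subset edges D, nk (subgraph D F) == 1
                             & cycles (subgraph D F) == set0]].

(* The half-edges [b] and [c] of [D] start at vertices in the same component
   of the subgraph with edge set [F]. *)
Definition joined D F b c :=
  connect [rel x y | (y == s0 D x) || (edge D x \in F) && (y == s1 D x)] b c.

Definition cut D F e : {set {set T}} :=
  [set e' in edges D | [exists b in e', ~~ joined D (F :\ e) b (s1 D b)]].

Definition smallest le e (E : {set {set T}}) :=
  (e \in E) && [forall e' in E, le e e'].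

Definition internally_active D le F : {set {set T}} :=
  [set e in F | smallest le e (cut D F e)].

Definition externally_active D le F : {set {set T}} :=
  [set e in edges D :\: F |
     [exists E in cycles (subgraph D (e |: F)), smallest le e E]].

Definition total_order_on (E : {set {set T}}) le : Prop :=
  [/\ {in E, reflexive le}, {in E &, antisymmetric le},
      {in E & &, transitive le} & {in E &, total le}].

End RibbonGraphs.

Section AllASplicing.
Variable T : finType.
Variables (P : diagram T) (o : T).
Implicit Types (x y : T) (C : {set T}).

(* [P] is drawn in the plane so that the face to the left of the dart [o] is
   the unbounded one. *)

Let tau : {perm T} := join true P.

Definition circle x : {set T} :=
  [set y | connect [rel u v | (v == flip P u) || (v == tau u)] x y].
Definition circles : {set {set T}} := [set circle x | x in darts P].

(* The next dart of the same circle in the direction of travel. *)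
Definition along : {perm T} := (flip P * tau)%g.

(* Two darts are connected if the faces to their left are in the same region
   of the complement of [C]: one may move within a face, through a corner that
   has been opened by an A-splicing, and across edges not in [C]. *)
Definition off_circle C : rel T :=
  [rel x y | [|| y == face P x,
                 [&& crossing P x, x \in over P & y == turn P (turn P x)]
               | (x \notin C) && (y == flip P x)]].

(* The face to the left of [x] lies inside [C]. *)
Definition inside C x := ~~ connect (off_circle C) o x.

(* The number of other circles that contain [C]. *)
Definition depth C : nat :=
  #|[set C' in circles | (C' != C) && [forall x in C, inside C' x]]|.

(* The direction of a dart [x] of the circle [C] is anticlockwise iff the
   inside of [C] is to its left.  To orient [C] we look at one dart of [C]. *)
Definition base x := odflt x [pick y in circle x].
Definition base_oriented x :=
  inside (circle x) (base x) (+) odd (depth (circle x)).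

(* [x] points in the direction of the orientation of its circle. *)
Definition oriented x := (x \in porbit along (base x)) == base_oriented x.

(* A directed splicing arc that starts on [C] is represented by the
   positively oriented dart of [C] that leaves its starting point. *)
Definition arcs : {set T} := [set x | crossing P x && oriented x].

Let fK x : x \in darts P -> flip P (flip P x) = x.
Proof. by have [_ + _ _ _] := diagramP P; apply. Qed.

Let fN x : x \in darts P -> flip P x != x.
Proof. by have [_ _ + _ _] := diagramP P; apply. Qed.

Lemma circle_step x y : x \in darts P -> y \in circle x ->
  y \in darts P /\ circle y = circle x.
Proof.
rewrite inE => xD /connectP[p + ->]; elim: p x xD => //= z p IH x xD /andP[xz pz].
have zD : z \in darts P.
  by case/orP: xz => /eqP ->; rewrite ?flip_darts ?join_darts.
have [-> ->] := IH z zD pz; split=> //; apply/setP=> y0; rewrite !inE.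
have zx : (x == flip P z) || (x == tau z).
  by case/orP: xz => /eqP ->; rewrite ?fK ?joinK ?eqxx ?orbT.
by apply/idP/idP; apply: connect_trans; apply: connect1.
Qed.

Lemma circle_tau x : x \in darts P -> circle (tau x) = circle x.
Proof.
move=> xD; have [//|//] := @circle_step x (tau x) xD.
by rewrite inE connect1 //= eqxx orbT.
Qed.

Lemma along_darts x : (along x \in darts P) = (x \in darts P).
Proof. by rewrite permM join_darts flip_darts. Qed.

Lemma along_tauK y : y \in darts P -> along (tau (along y)) = tau y.
Proof. by move=> yD; rewrite !permM joinK ?flip_darts // fK. Qed.

Lemma along_tau n y : y \in darts P -> iter n along y <> tau y.
Proof.
have [m] := ubnP n; elim: m n y => // m IH [|[|n]] y nm yD /=.
- by move=> e; have := join_neq true yD; rewrite -[join _ _ _]e eqxx.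
- by rewrite permM => /perm_inj e; have := fN yD; rewrite e eqxx.
- move=> e; apply: (IH n (along y)); rewrite ?along_darts //.
    exact: ltnW.
  by rewrite -iterSr iterS; apply: (@perm_inj _ along); rewrite along_tauK.
Qed.

Lemma circle_along h y : h \in darts P -> y \in circle h ->
  (y \in porbit along h) || (tau y \in porbit along h).
Proof.
move=> hD; rewrite inE => /connectP[p]; elim/last_ind: p y => [|p z IH] y.
  by move=> _ ->; rewrite porbit_id.
rewrite rcons_path last_rcons => /andP[hp /= lz] ->{y}.
have {IH} := IH _ hp erefl; have : last h p \in darts P.
  have [] // := @circle_step h (last h p) hD; rewrite inE; apply/connectP.
  by exists p.
move: (last h p) lz => w /orP[]/eqP -> wD; last by rewrite joinK // orbC.
case/orP=> wh; apply/orP; [right|left].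
  have -> : tau (flip P w) = along w by rewrite permM.
  by rewrite -eq_porbit_mem porbit1 eq_porbit_mem.
have : along (flip P w) \in porbit along h by rewrite permM fK.
by rewrite -!eq_porbit_mem porbit1.
Qed.

Lemma base_circle x : base x \in circle x.
Proof. by rewrite /base; case: pickP => [//|/(_ x)]; rewrite inE connect0. Qed.

Lemma oriented_tau x : x \in darts P -> oriented (tau x) = ~~ oriented x.
Proof.
move=> xD; have xx : x \in circle x by rewrite inE connect0.
have [bD cb] := circle_step xD (base_circle x).
have bt : base (tau x) = base x.
  by rewrite /base circle_tau //; case: pickP => // /(_ x); rewrite xx.
rewrite /oriented /base_oriented bt circle_tau //.
set c := _ (+) _; suff -> : (tau x \in porbit along (base x)) =
  (x \notin porbit along (base x)) by case: c; case: (_ \in _).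
have := @circle_along (base x) x bD; rewrite cb => /(_ xx).
case xb: (x \in _) => //= xt; apply/negP => tb.
have : tau x \in porbit along x.
  by move: xb tb; rewrite -!eq_porbit_mem => /eqP -> /eqP ->.
by case/porbitP=> i; rewrite permX => /esym; apply: along_tau.
Qed.

Definition opposite_arc_fun x :=
  if x \in arcs then
    let y := turn P (turn P x) in if oriented y then y else tau y
  else x.

Lemma arcs_darts x : x \in arcs -> x \in darts P.
Proof. by rewrite inE => /andP[/andP[]]. Qed.

Lemma opposite_arc_arcs x : (opposite_arc_fun x \in arcs) = (x \in arcs).
Proof.
rewrite /opposite_arc_fun; case: ifP => // xa.
have xD := arcs_darts xa; move: xa; rewrite !inE => /andP[cx _].
have tD : turn P (turn P x) \in darts P by rewrite !turn_darts.
case: ifP => oy; first by rewrite !crossing_turn cx.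
by rewrite oriented_tau // oy permE crossing_join !crossing_turn cx.
Qed.

Lemma turn2K x : crossing P x -> turn P (turn P (turn P (turn P x))) = x.
Proof.
by case/andP=> xD /eqP c4; have := iter_porbit (turn P) x; rewrite c4.
Qed.

Lemma turn2_tau x : crossing P x ->
  turn P (turn P (tau x)) = tau (turn P (turn P x)).
Proof.
move=> cx; rewrite !permE /join_fun !crossing_turn cx /= !over_turn ?crossing_turn //.
rewrite negbK; case: ifP => // _; rewrite permKV.
by rewrite permK.
Qed.

Lemma opposite_arcK x : x \in arcs -> opposite_arc_fun (opposite_arc_fun x) = x.
Proof.
move=> xa; rewrite {1}/opposite_arc_fun opposite_arc_arcs xa.
have xD := arcs_darts xa; rewrite /opposite_arc_fun xa.
move: xa; rewrite !inE => /andP[cx ox] /=.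
case oy: (oriented (turn P (turn P x))); first by rewrite turn2K // ox.
rewrite turn2_tau ?crossing_turn // turn2K // oriented_tau // ox /=.
by rewrite joinK.
Qed.

Lemma opposite_arc_fun_inj : injective opposite_arc_fun.
Proof.
move=> x y e; have := opposite_arc_arcs x; rewrite e opposite_arc_arcs.
case ya: (y \in arcs) => xa.
  by rewrite -(@opposite_arcK x) -?xa // e opposite_arcK.
by move: e; rewrite /opposite_arc_fun ya -xa.
Qed.

(* At the same crossing, the positively oriented dart of the opposite strand. *)
Definition opposite_arc : {perm T} := perm opposite_arc_fun_inj.

Lemma opposite_arc_neq x : x \in arcs -> opposite_arc x != x.
Proof.
move=> xa; rewrite permE /opposite_arc_fun xa; move: xa; rewrite !inE => /andP[cx _].
have c1 : crossing P (turn P x) by rewrite crossing_turn.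
have c2 : crossing P (turn P (turn P x)) by rewrite crossing_turn.
apply/eqP; case: ifP => _ e; last first.
  have : (tau (turn P (turn P x)) \in over P) = (turn P (turn P x) \notin over P).
    exact: over_join.
  by rewrite e !over_turn // negbK; case: (_ \in _).
have t1 : turn P x != x.
  by apply/eqP => e1; have := over_turn cx; rewrite e1; case: (_ \in _).
by case/andP: cx => _; rewrite card_porbit2.
Qed.

Lemma all_A_subproof : {in arcs, forall b,
  [/\ return_perm along arcs b \in arcs, opposite_arc b \in arcs,
      opposite_arc (opposite_arc b) = b & opposite_arc b != b]}.
Proof.
move=> b ba; split; last exact: opposite_arc_neq.
- by rewrite permE return_fun_in.
- by rewrite permE opposite_arc_arcs.
- by rewrite permE [opposite_arc b]permE opposite_arcK.
Qed.

Definition all_A_ribbon_graph : ribbon_graph T := @RibbonGraph T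
  arcs (return_perm along arcs) opposite_arc
  #|[set C in circles | crossingless P C]| all_A_subproof.

End AllASplicing.

(* Main.v *)
Require Import Defs.
From mathcomp Require Import all_boot all_fingroup all_algebra zify ring.

(** The rule for crossings, applied everywhere, writes [delta * p] as a sum over
    the sets of B-spliced crossings, in which a set [S] contributes
    [A ^ (e - 2 #|S|)] times [delta] to the number of circles of the state
    ([kauffman_state_sum]).  Crossings are edges of [D].  The circles of a state
    are the boundary curves of the surface made of the discs of [D] and of the
    ribbons in [S], that is, the faces of the subgraph with edges [S]
    ([loops_subgraph]).  Hence [A ^- e * p] is [delta^-1] times the sum over all
    edge sets [F] of the weight [W F = A ^- (2 #|F|) * delta ^ f(F)].

    That state circles are faces requires the orientations of the circles to be
    compatible with the ribbons: at a crossing, the two A-spliced strands have to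
    run in opposite directions.  Planarity enters here.  Crossing a circle leads
    from its outside to its inside or back ([inside_coboundary]); this form of
    Jordan's theorem follows from the vanishing of the first cohomology of the
    sphere, which is a matter of comparing the ranks of incidence matrices by
    Euler's formula ([planar_coboundary]).  So a dart points in the direction of
    its circle iff the region to its left lies inside an odd number of circles
    ([oriented_parity]), and the corners opened by the splicing connect the
    regions to the left of opposite darts ([oriented_opposite]).

    The expansion over spanning trees ([spanning_tree_expansion]) holds for every
    weight [W] such that [W (F :\ e) = (X - 1) * W F] for bridges [e] of [F].  The
    edges are decided in decreasing order.  When the largest undecided edge [e] is
    considered, the edge sets that remain are those between the set [A] of edges
    already taken and the set [B] of edges not yet discarded.  If [e] is a bridge
    of [B], it is internally active for all trees in this range and contributes
    the factor [X]; if its ends are joined in [A], it is externally active for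
    all of them; otherwise it is never active.  In the case at hand, removing a
    bridge adds a face ([nf_bridge]), as the boundary walk changes by a
    transposition, so [X - 1 = A ^+ 2 * delta].

    A tree together with externally active edges is connected, and for connected
    [F] the formula [2 g = 2 - v + e - f] turns [W F] into
    [delta * A ^ (2 - 2 v) * Y ^ n * Z ^ g] ([expansion_weight]). *)

Set Implicit Arguments.
Unset Strict Implicit.
Unset Printing Implicit Defensive.

Import GRing.Theory.

(** * Orbits and first returns *)

Section Counting.

Lemma card_imset_eq (aT rT rT' : finType) (f : aT -> rT) (g : aT -> rT')
    (B : {set aT}) :
  {in B &, forall x y, (f x == f y) = (g x == g y)} -> #|f @: B| = #|g @: B|.
Proof.
move=> fg; pose h x := (f x, g x).
have hB (rT1 : finType) (u : rT * rT' -> rT1) :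
    {in h @: B &, injective u} -> #|(u \o h) @: B| = #|h @: B|.
  by move=> u_inj; rewrite imset_comp (card_in_imset u_inj).
transitivity #|h @: B|; [apply: (hB _ fst) | apply/esym/(hB _ snd)] => ? ?.
  move=> /imsetP[x xB ->] /imsetP[y yB ->] /= e.
  by apply/eqP; rewrite xpair_eqE -fg // e eqxx.
move=> /imsetP[x xB ->] /imsetP[y yB ->] /= e.
by apply/eqP; rewrite xpair_eqE fg // e eqxx.
Qed.

Lemma card_eq_in_imset (aT rT : finType) (f g : aT -> rT) (B : {set aT}) :
  {in B, f =1 g} -> #|f @: B| = #|g @: B|.
Proof. by move/eq_in_imset->. Qed.

Lemma card_class_split (T : finType) (c : T -> {set T}) (X B : {set T}) :
    (forall x, x \in c x) -> (forall x y, y \in c x -> c y = c x) ->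
    B \subset X ->
  #|c @: X| = #|c @: B| + #|[set C in c @: X | [disjoint C & B]]|.
Proof.
move=> c_id c_eq /subsetP BX.
rewrite -(cardsID [set C : {set T} | [disjoint C & B]]) addnC.
congr (_ + _); apply: eq_card => C; rewrite !inE //.
apply/andP/imsetP => [[nd /imsetP[x xX eC]]|[x xB ->]].
  move: nd; rewrite -setI_eq0 => /set0Pn[y /setIP[yC yB]].
  by exists y => //; rewrite eC (c_eq x) // -eC.
split; last by rewrite imset_f ?BX.
by apply/pred0Pn; exists x; rewrite /= c_id.
Qed.

End Counting.

Section FirstReturn.
Variable T : finType.
Implicit Types (s t : {perm T}) (B X : {set T}).

Lemma porbit_class s x y : y \in porbit s x -> porbit s y = porbit s x.
Proof. by rewrite -eq_porbit_mem => /eqP. Qed.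

Lemma porbit_involution s x : s x != x -> s (s x) = x -> porbit s x = [set x; s x].
Proof.
move=> sx ssx; apply/eqP; rewrite eq_sym eqEcard cards2 eq_sym sx.
rewrite card_porbit2 // andbT; apply/subsetP=> y.
by rewrite !inE => /orP[]/eqP->; rewrite ?porbit_id // -eq_porbit_mem porbit1.
Qed.

Lemma return_fun_uniq s B x k : x \in B -> iter k.+1 s x \in B ->
    (forall j, 0 < j -> j <= k -> iter j s x \notin B) ->
  return_fun s B x = iter k.+1 s x.
Proof.
move=> xB kB km; have [l -> [lB lm]] := return_funP s xB.
have [kl|lk|-> //] := ltngtP k l.
  by have := lm k.+1 isT kl; rewrite kB.
by have := km l.+1 isT lk; rewrite lB.
Qed.

(** Each visit of an orbit to [B] is the first return from the visit before it. *)
Lemma porbit_return s B x : x \in B ->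
  porbit (return_perm s B) x = porbit s x :&: B.
Proof.
move=> xB; apply/setP=> y; apply/idP/setIP => [xy|[]].
  have st : {in porbit s x :&: B,
      forall z, return_perm s B z \in porbit s x :&: B}.
    move=> z /setIP[xz zB]; rewrite inE permE return_fun_in zB andbT.
    have [k -> _] := return_funP s zB.
    by rewrite -permX -(porbit_class xz) mem_porbit.
  apply/setIP; rewrite -(porbit_stable st xy).
  by rewrite inE porbit_id xB.
case/porbitP=> i ->{y}; have [n] := ubnP i.
elim: n i x xB => // n IH [|i] x xB lin yB; first by rewrite expg0 perm1 porbit_id.
have [k ek [_ km]] := return_funP s xB.
have ki : k <= i.
  by rewrite leqNgt; apply/negP => ik; have := km _ (ltn0Sn _) ik; rewrite -permX yB.
have rB : return_perm s B x \in B by rewrite permE return_fun_in.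
have e : (s ^+ i.+1)%g x = (s ^+ (i - k))%g (return_perm s B x).
  by rewrite permE ek !permX -iterD addnS subnK.
rewrite -(porbit1 (return_perm s B)) e.
by apply: IH; [| apply: leq_ltn_trans (leq_subr _ _) _ | rewrite -e].
Qed.

(** As [t] moves points of [B] only, it does not change the way from one visit
    to [B] to the next. *)
Lemma return_permM s t B : {in B, forall x, t x \in B} ->
    (forall x, x \notin B -> t x = x) ->
  {in B, return_perm (t * s)%g B =1 (t * return_perm s B)%g}.
Proof.
move=> tB tN x xB; have [k ek [kB km]] := return_funP s (tB x xB).
have it j : j <= k -> iter j.+1 (t * s)%g x = iter j.+1 s (t x).
  elim: j => [_|j IH jk]; first by rewrite /= permM.
  by rewrite iterS IH 1?ltnW // permM tN // km.
rewrite permM [LHS]permE [return_perm s B _]permE ek -it //.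
by apply: return_fun_uniq; rewrite ?it // => -[//|j] _ jk; rewrite it 1?ltnW ?km.
Qed.

(** Orbits of [t * s] that meet [B] can be counted on [B]; the others never meet
    the support of [t], so they are orbits of [s].  With [t] a product of ribbons,
    this compares boundary walks on a set of half-edges and on a subset of it. *)
Lemma card_porbit_return s t B X : {in B, forall x, t x \in B} ->
    (forall x, x \notin B -> t x = x) -> B \subset X ->
  #|porbit (t * s)%g @: X| =
    #|porbit (t * return_perm s B)%g @: B|
      + #|[set C in porbit s @: X | [disjoint C & B]]|.
Proof.
move=> tB tN BX.
rewrite (card_class_split (B := B)) //; last 2 first.
- exact: porbit_id.
- exact: porbit_class.
congr (_ + _).
  apply: card_imset_eq => x y xB yB; rewrite !eq_porbit_mem.
  have E : porbit (t * return_perm s B)%g y = porbit (return_perm (t * s) B)%g y.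
    apply: porbit_eq_on => z; rewrite porbit_return // => /setIP[_ zB].
    exact: return_permM.
  by rewrite E porbit_return // inE xB andbT.
have st x : x \notin B -> (t * s)%g x = s x by move=> /tN e; rewrite permM e.
have e s1 s2 x : {in ~: B, s1 =1 s2} -> [disjoint porbit s1 x & B] ->
    porbit s2 x = porbit s1 x.
  move=> s12 d; apply: porbit_eq_on => y yx.
  by apply: s12; rewrite inE (disjointFr d).
have e1 : {in ~: B, s =1 (t * s)%g} by move=> x; rewrite inE => /st.
have e2 : {in ~: B, (t * s)%g =1 s} by move=> x; rewrite inE => /st.
apply: eq_card => C; rewrite !inE; apply/andP/andP => -[/imsetP[x xX ->] d].
  by split=> //; rewrite -(e _ _ _ e2) // imset_f.
by split=> //; rewrite -(e _ _ _ e1) // imset_f.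
Qed.

Lemma porbitM_sym s t x y :
  (s y \in porbit (t * s)%g (s x)) = (y \in porbit (s * t)%g x).
Proof.
have E i : ((t * s) ^+ i)%g (s x) = s (((s * t) ^+ i)%g x).
  by elim: i => [|i IH]; rewrite ?expg0 ?perm1 // !expgSr !permM IH.
by apply/porbitP/porbitP => -[i]; [rewrite E => /perm_inj->|move->];
  exists i; rewrite ?E.
Qed.

Lemma card_porbitM_sym s t X : {in X, forall x, s x \in X} ->
  #|porbit (s * t)%g @: X| = #|porbit (t * s)%g @: X|.
Proof.
move=> sX; have {2}<- : s @: X = X.
  apply/eqP; rewrite eqEcard card_imset ?leqnn ?andbT; last exact: perm_inj.
  by apply/subsetP=> _ /imsetP[x xX ->]; apply: sX.
rewrite -imset_comp; apply: card_imset_eq => x y _ _.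
by rewrite !eq_porbit_mem /= porbitM_sym.
Qed.

End FirstReturn.

(** * Vertices, edges and faces of subgraphs *)

Section PermConnect.
Variable T : finType.

(** A step along a permutation is undone by going round its orbit. *)
Lemma connect_perm_sym (s t : {perm T}) (a : pred T) :
    (forall x, a (t x) = a x) ->
  connect_sym [rel x y | (y == s x) || a x && (y == t x)].
Proof.
move=> at_; set e := (X in connect_sym X).
have iter_s n x : connect e x (iter n s x).
  elim: n => [|n IH]; first exact: connect0.
  by apply: connect_trans IH (connect1 _); rewrite /e /= eqxx.
have iter_t n x : a x -> connect e x (iter n t x).
  move=> ax; elim: n => [|n IH]; first exact: connect0.
  apply: connect_trans IH (connect1 _); rewrite /e /= eqxx andbT orbC.
  by rewrite (_ : a _ = a x) ?ax //; elim: n => //= n IH; rewrite at_.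
have back (u : {perm T}) x : x = iter #|porbit u x|.-1 u (u x).
  by rewrite -iterSr prednK ?iter_porbit // lt0n card_porbit_neq0.
have step x y : e x y -> connect e y x.
  case/orP=> [/eqP->|/andP[ax /eqP->]]; first by rewrite {2}(back s x).
  by rewrite {2}(back t x) iter_t // at_.
have cs x y : connect e x y -> connect e y x.
  case/connectP=> p; elim: p x => [|z p IH] x /=; first by move=> _ ->.
  by case/andP=> /step zx ep ey; apply: connect_trans (IH _ ep ey) zx.
by move=> x y; apply/idP/idP; apply: cs.
Qed.

Lemma connect_class (e : rel T) x y : connect_sym e ->
  ([set z | connect e x z] == [set z | connect e y z]) = connect e x y.
Proof.
move=> e_sym; apply/eqP/idP => [E|xy]; last first.
  by apply/setP=> z; rewrite !inE (same_connect e_sym xy).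
by move/setP/(_ y): E; rewrite !inE connect0.
Qed.

(** The counterpart of [card_porbit_return] for connected components: a component
    that meets [B] is determined by its points in [B], and these are connected by
    [t] and by first returns. *)
Lemma card_connect_return (s t : {perm T}) (B X : {set T}) :
    (forall x, (t x \in B) = (x \in B)) -> B \subset X ->
  #|[set [set y | connect [rel u v | (v == s u) || (u \in B) && (v == t u)] x y]
       | x in X]| =
    #|[set [set y | connect [rel u v | (v == return_perm s B u) || (v == t u)] x y]
         | x in B]|
      + #|[set C in porbit s @: X | [disjoint C & B]]|.
Proof.
move=> tB BX; set e := [rel u v | _ || _ && _]; set r := [rel u v | _ || (v == t u)].
have e_sym : connect_sym e := connect_perm_sym s (a := mem B) tB.
have r_sym : connect_sym r := connect_perm_sym (return_perm s B) (t := t) (a := predT) (fun=> erefl).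
have orb x y : y \in porbit s x -> connect e x y.
  case/porbitP=> i ->; elim: i => [|i IH]; first by rewrite expg0 perm1.
  by rewrite expgSr permM; apply: connect_trans IH (connect1 _); rewrite /= eqxx.
rewrite (card_class_split (B := B)) //; last 2 first.
- by move=> x; rewrite inE.
- by move=> x y; rewrite inE => xy; apply/eqP; rewrite connect_class // e_sym.
congr (_ + _).
  apply: card_imset_eq => x y xB yB; rewrite !connect_class //; apply/idP/idP.
    have ret u v : u \in B -> v \in B -> v \in porbit s u -> connect r u v.
      move=> uB vB uv; have : v \in porbit (return_perm s B) u.
        by rewrite porbit_return // inE uv.
      case/porbitP=> i ->; elim: i {v uv vB} => [|i IH]; first by rewrite expg0 perm1.
      by rewrite expgSr permM (connect_trans IH) // connect1 //= eqxx.
    suff H p v : path e x p -> v \in B -> v \in porbit s (last x p) -> connect r x v.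
      by case/connectP=> p xp ey; apply: (H p y xp yB); rewrite ey porbit_id.
    elim/last_ind: p v => [|p z IH] v /=; first by move=> _ vB; apply: ret.
    rewrite rcons_path last_rcons => /andP[xp /= /orP[/eqP->|/andP[lB /eqP->]]] vB.
      by rewrite porbit1; apply: IH.
    move=> lv; apply: connect_trans (ret _ _ _ vB lv); last by rewrite tB.
    by apply: connect_trans (IH _ xp lB (porbit_id _ _)) (connect1 _); rewrite /= eqxx orbT.
  case/connectP=> p; elim: p x xB => [|z p IH] x xB /=; first by move=> _ ->.
  case/andP=> /orP[]/eqP-> zp ey; apply: connect_trans (IH _ _ zp ey).
  - apply: orb; have : return_perm s B x \in porbit (return_perm s B) x.
      by rewrite -eq_porbit_mem porbit1.
    by rewrite porbit_return // inE => /andP[].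
  - by rewrite permE return_fun_in.
  - by rewrite connect1 //= xB eqxx orbT.
  - by rewrite tB.
have out x : [disjoint porbit s x & B] -> [set y | connect e x y] = porbit s x.
  move=> d; apply/setP=> y; rewrite inE; apply/idP/idP; last exact: orb.
  case/connectP=> p + ->; elim/last_ind: p => [|p z IH] /=; first by rewrite porbit_id.
  rewrite rcons_path last_rcons => /andP[/IH xl /= /orP[/eqP->|/andP[lB _]]].
    by rewrite -eq_porbit_mem porbit1 eq_porbit_mem.
  by have := disjointFr d xl; rewrite lB.
apply: eq_card => C; rewrite !inE; apply/andP/andP => -[/imsetP[x xX ->] d].
  have d' : [disjoint porbit s x & B].
    by apply: disjointWl d; apply/subsetP=> y; rewrite inE; apply: orb.
  by split=> //; rewrite out // imset_f.
by split=> //; apply/imsetP; exists x; rewrite ?out.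
Qed.

End PermConnect.

Section RibbonCounts.
Variables (T : finType) (D : ribbon_graph T).
Implicit Types (b c x y : T) (e : {set T}) (F : {set {set T}}).

Lemma s0_halves b : (s0 D b \in halves D) = (b \in halves D).
Proof.
rewrite (@porbit_stable _ (s0 D) (halves D) _ b (s0 D b)) //.
  by move=> x /(@ribbonP _ D)[].
by rewrite -eq_porbit_mem porbit1.
Qed.

Lemma s1_halves b : (s1 D b \in halves D) = (b \in halves D).
Proof.
rewrite (@porbit_stable _ (s1 D) (halves D) _ b (s1 D b)) //.
  by move=> x /(@ribbonP _ D)[].
by rewrite -eq_porbit_mem porbit1.
Qed.

Lemma s1K b : b \in halves D -> s1 D (s1 D b) = b.
Proof. by case/(@ribbonP _ D). Qed.

Lemma s1_neq b : b \in halves D -> s1 D b != b.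
Proof. by case/(@ribbonP _ D). Qed.

Lemma edgeE b : b \in halves D -> edge D b = [set b; s1 D b].
Proof. by move=> bD; rewrite /edge porbit_involution ?s1K ?s1_neq. Qed.

Lemma mem_edge b : b \in edge D b. Proof. exact: porbit_id. Qed.

Lemma edge_class b c : c \in edge D b -> edge D c = edge D b.
Proof. exact: porbit_class. Qed.

Lemma edgesP e : reflect (exists2 b, b \in halves D & e = edge D b) (e \in edges D).
Proof. exact: imsetP. Qed.

Lemma edges_mem e b : e \in edges D -> b \in e -> b \in halves D /\ edge D b = e.
Proof.
case/edgesP=> c cD -> bc; split; last exact: edge_class.
by move: bc; rewrite edgeE // !inE => /orP[]/eqP->; rewrite ?s1_halves.
Qed.

Lemma sub_halvesW F : sub_halves D F \subset halves D.
Proof. by apply/subsetP=> b; rewrite inE => /andP[]. Qed.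

Lemma s1_sub_halves F b : (s1 D b \in sub_halves D F) = (b \in sub_halves D F).
Proof. by rewrite !inE s1_halves edge_s1. Qed.

(** Unlike [s1 D], this is the identity on the half-edges of omitted edges, so
    that all subgraphs are described on the same set of half-edges. *)
Definition ribbon_fun F b := if b \in sub_halves D F then s1 D b else b.

Lemma ribbon_fun_inj F : injective (ribbon_fun F).
Proof.
move=> b c; rewrite /ribbon_fun.
case: ifP => bF; case: ifP => cF; [exact: perm_inj| | |by []] => e.
  by move: cF; rewrite -e s1_sub_halves bF.
by move: bF; rewrite e s1_sub_halves cF.
Qed.

Definition ribbon_perm F : {perm T} := perm (@ribbon_fun_inj F).

Lemma ribbon_permE F b :
  ribbon_perm F b = if b \in sub_halves D F then s1 D b else b.
Proof. exact: permE. Qed.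

Lemma ribbon_perm_out F b : b \notin sub_halves D F -> ribbon_perm F b = b.
Proof. by rewrite ribbon_permE => /negPf->. Qed.

Lemma ribbon_perm_in F :
  {in sub_halves D F, forall b, ribbon_perm F b \in sub_halves D F}.
Proof. by move=> b bF; rewrite ribbon_permE bF s1_sub_halves. Qed.

(** Its orbits are the boundary curves of the surface made of the discs of all
    vertices and of the ribbons in [F].  It acts on all half-edges of [D], in
    contrast to [s2] of the subgraph, which makes different [F] comparable. *)
Definition boundary F : {perm T} := (ribbon_perm F * s0 D)%g.

(** Up to inversion, [s2] of the subgraph is the first return of the boundary
    walk to the half-edges of [F]; the boundary curves without ribbons surround
    vertices that are isolated in the subgraph. *)
Lemma nf_subgraph F :
  nf (subgraph D F) = #|porbit (boundary F) @: halves D| + isolated D.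
Proof.
rewrite (@card_porbit_return _ (s0 D) (ribbon_perm F) (sub_halves D F)); last 3 first.
- exact: ribbon_perm_in.
- exact: ribbon_perm_out.
- exact: sub_halvesW.
rewrite /nf /= [isolated D + _]addnC addnA; congr (_ + _ + _).
apply: card_eq_in_imset => b bF.
rewrite /s2 porbitV; apply: porbit_eq_on => c bc.
rewrite !permM ribbon_permE -(@porbit_stable _ _ _ _ b c bc) ?bF // => x xF.
by rewrite permM permE return_fun_in ribbon_perm_in.
Qed.

Lemma nv_subgraph F : nv (subgraph D F) = nv D.
Proof.
rewrite /nv /= [isolated D + _]addnC addnA; congr (_ + _).
rewrite (@card_class_split _ (vertex D) (halves D) (sub_halves D F)); last 3 first.
- exact: porbit_id.
- by move=> b c; apply: porbit_class.
- exact: sub_halvesW.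
congr (_ + _); apply: card_imset_eq => b c bF cF.
by rewrite !eq_porbit_mem porbit_return // inE bF andbT.
Qed.

Lemma edges_subgraph F : F \subset edges D -> edges (subgraph D F) = F.
Proof.
move=> /subsetP FD; apply/setP=> e; apply/imsetP/idP => [[b]|eF].
  by rewrite inE => /andP[_ bF] ->.
by have /edgesP[b bD eb] := FD _ eF; exists b; rewrite // inE bD -eb.
Qed.

Lemma nf_subgraph0 : nf (subgraph D set0) = nv D.
Proof.
rewrite nf_subgraph /nv; congr (_ + _).
apply: card_eq_in_imset => b bD; apply: porbit_eq_on => c _.
by rewrite permM ribbon_permE !inE andbF.
Qed.

(** A new ribbon exchanges the continuations of the boundary walks at its ends. *)
Lemma boundary_add F b : b \in halves D -> edge D b \notin F ->
  boundary (edge D b |: F) = (tperm b (s1 D b) * boundary F)%g.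
Proof.
move=> bD bF; apply/permP=> c; rewrite !permM !ribbon_permE; congr (s0 D _).
have sbF : b \notin sub_halves D F by rewrite inE negb_and bF orbT.
have inF c' : (c' \in sub_halves D (edge D b |: F)) =
    (c' \in halves D) && (edge D c' == edge D b) || (c' \in sub_halves D F).
  by rewrite !inE andb_orr.
rewrite inF; case: tpermP => [->|->|/eqP cb /eqP csb].
- by rewrite bD eqxx /= s1_sub_halves (negPf sbF).
- by rewrite s1_halves bD edge_s1 eqxx (negPf sbF) /= s1K.
case cD: (c \in halves D) => /=; last by rewrite inE cD.
rewrite (_ : (edge D c == _) = false) //; apply/negbTE.
by rewrite eq_porbit_mem -/(edge D b) edgeE // !inE negb_or cb.
Qed.

(** A transposition merges two orbits or splits one. *)
Lemma card_boundary_add F b : b \in halves D -> edge D b \notin F ->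
  #|porbit (boundary (edge D b |: F)) @: halves D|
    + (b \notin porbit (boundary F) (s1 D b)).*2
  = #|porbit (boundary F) @: halves D| + 1.
Proof.
move=> bD bF.
have all_orbits G : #|porbits (boundary G)| = #|porbit (boundary G) @: halves D|
    + #|[set C in porbits (s0 D) | [disjoint C & halves D]]|.
  have st : {in halves D, forall c, ribbon_perm G c \in halves D}.
    by move=> c cD; rewrite ribbon_permE; case: ifP; rewrite ?s1_halves.
  have out c : c \notin halves D -> ribbon_perm G c = c.
    by move=> cD; rewrite ribbon_permE inE (negPf cD).
  have pT s : porbits s = porbit s @: [set: T].
    by apply/setP=> C; apply/imsetP/imsetP=> -[x _ ->]; exists x.
  rewrite !pT [LHS](card_porbit_return _ st out) ?subsetT // [in RHS](card_porbit_return _ st out) //.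
  rewrite [X in _ = _ + X + _](_ : _ = 0) ?addn0 //.
  apply/eqP; rewrite cards_eq0; apply/eqP/setP=> C; rewrite !inE; apply/negbTE.
  apply/negP=> /andP[/imsetP[c cD ->]] /disjointFr /(_ (porbit_id _ _)).
  by rewrite cD.
have := porbits_mul_tperm (boundary F) b (s1 D b).
rewrite /= -boundary_add // !all_orbits eq_sym s1_neq //.
by rewrite -!addnA [X in _ + X]addnC [X in _ = _ + X]addnC !addnA => /addIn.
Qed.

(** Each ribbon changes the number of boundary curves by one.  This parity is
    what makes the division by 2 in [genus] exact. *)
Lemma odd_nf_subgraph F : F \subset edges D ->
  odd (nf (subgraph D F)) = odd (nv D + #|F|).
Proof.
have [n] := ubnP #|F|; elim: n F => // n IH F nF FD.
have [->|[e eF]] := set_0Vmem F; first by rewrite nf_subgraph0 cards0 addn0.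
have /edgesP[b bD eb] := subsetP FD _ eF.
rewrite (cardsD1 e) eF /= in nF *.
have {IH} := IH (F :\ e) nF (subset_trans (subD1set _ _) FD).
have eF' : edge D b \notin F :\ e by rewrite -eb !inE eqxx.
have := card_boundary_add bD eF'; rewrite -eb setD1K // !nf_subgraph => E.
rewrite add1n addnS oddS => <-; have := congr1 odd E.
by rewrite addn1 !oddD odd_double addbF => ->; rewrite oddS addNb.
Qed.

End RibbonCounts.

(** * Joined half-edges and bridges *)

Section Joined.
Variables (T : finType) (D : ribbon_graph T).
Implicit Types (a b c x y : T) (e : {set T}) (F G : {set {set T}}).

Lemma joined_refl F b : joined D F b b. Proof. exact: connect0. Qed.

Lemma joined_trans F c b d : joined D F b c -> joined D F c d -> joined D F b d.
Proof. exact: connect_trans. Qed.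

Lemma joined_sym F b c : joined D F b c = joined D F c b.
Proof.
by apply: (@connect_perm_sym _ (s0 D) (s1 D) [pred x | edge D x \in F]) => x;
  rewrite /= edge_s1.
Qed.

Lemma joined_s0 F b : joined D F b (s0 D b).
Proof. by apply: connect1; rewrite /= eqxx. Qed.

Lemma joined_s1 F b : edge D b \in F -> joined D F b (s1 D b).
Proof. by move=> bF; apply: connect1; rewrite /= bF eqxx orbT. Qed.

Lemma joined_ind F b (Q : T -> Prop) :
    Q b -> (forall x, joined D F b x -> Q x -> Q (s0 D x)) ->
    (forall x, joined D F b x -> Q x -> edge D x \in F -> Q (s1 D x)) ->
  forall c, joined D F b c -> Q c.
Proof.
move=> Qb Q0 Q1 c /connectP[p].
elim/last_ind: p c => [|p z IH] c; first by move=> _ ->.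
rewrite rcons_path last_rcons => /andP[bp /= lz] ->{c}.
have bl : joined D F b (last b p) by apply/connectP; exists p.
have Ql := IH _ bp erefl.
by case/orP: lz => [/eqP->|/andP[lF /eqP->]]; [apply: Q0 | apply: Q1].
Qed.

Lemma joinedS F G b c : F \subset G -> joined D F b c -> joined D G b c.
Proof.
move=> /subsetP FG; move: c; apply: joined_ind => [|x _ bx|x _ bx xF].
- exact: joined_refl.
- exact: joined_trans bx (joined_s0 _ _).
- exact: joined_trans bx (joined_s1 (FG _ xF)).
Qed.

Lemma joined_halves F b c : joined D F b c -> b \in halves D -> c \in halves D.
Proof.
move=> bc bD; move: c bc.
by apply: joined_ind => // x _ xD; rewrite ?s0_halves ?s1_halves.
Qed.

(** For [e] outside of [F], this says that [e] is not a bridge of [e |: F]. *)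
Definition linked F e := [forall b in e, joined D F b (s1 D b)].

Lemma linkedE F b : b \in halves D -> linked F (edge D b) = joined D F b (s1 D b).
Proof.
move=> bD; apply/forall_inP/idP => [-> //|bs c]; first exact: mem_edge.
by rewrite edgeE // !inE => /orP[]/eqP-> //; rewrite s1K // joined_sym.
Qed.

Lemma linkedS F G e : F \subset G -> linked F e -> linked G e.
Proof.
by move=> FG /forall_inP H; apply/forall_inP=> b /H; apply: joinedS.
Qed.

Lemma linked_in F e : e \in edges D -> e \in F -> linked F e.
Proof.
case/edgesP=> b bD -> bF; rewrite linkedE //; exact: joined_s1.
Qed.

(** A path needs to pass [e] at most once. *)
Lemma joined_addP F e b c : e \in edges D -> joined D (e |: F) b c ->
  joined D F b c \/
  exists2 a, a \in e & joined D F b a /\ joined D F (s1 D a) c.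
Proof.
move=> eD; move: c; apply: joined_ind => [|x _ IH|x _ IH]; first by left; apply: joined_refl.
  case: IH => [bx|[a ae [ba ax]]]; [left|right; exists a => //; split=> //].
    exact: joined_trans bx (joined_s0 _ _).
  exact: joined_trans ax (joined_s0 _ _).
rewrite !inE => /orP[/eqP xe|xF]; last first.
  case: IH => [bx|[a ae [ba ax]]]; [left|right; exists a => //; split=> //].
    exact: joined_trans bx (joined_s1 _).
  exact: joined_trans ax (joined_s1 _).
case: IH => [bx|[a ae [ba ax]]].
  by right; exists x; [rewrite -xe mem_edge | rewrite joined_refl].
have [aD ea] := edges_mem eD ae.
have : x \in edge D a by rewrite ea -xe mem_edge.
rewrite edgeE // !inE => /orP[]/eqP->; last by rewrite s1K //; left.
by right; exists a; rewrite // joined_refl.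
Qed.

(** The exchange property of the graphic matroid: a path between the ends of [e']
    has to pass through [e]. *)
Lemma linked_exchange F e e' : e \in edges D -> e' \in edges D ->
  linked (e |: F) e' -> ~~ linked F e' -> linked (e' |: F) e.
Proof.
move=> eD /edgesP[c cD ->]; rewrite !linkedE // => /(joined_addP eD)[-> //|].
case=> a ae [ca sac] _; have [aD <-] := edges_mem eD ae.
have sF : F \subset edge D c |: F by rewrite subsetUr.
rewrite linkedE //; apply: (@joined_trans _ c); first by rewrite joined_sym (joinedS sF).
apply: (@joined_trans _ (s1 D c)); first by rewrite joined_s1 // !inE eqxx.
by rewrite joined_sym (joinedS sF).
Qed.

Lemma joined_linked F e b c : e \in edges D -> linked F e ->
  joined D (e |: F) b c -> joined D F b c.
Proof.
move=> eD /forall_inP eF /(joined_addP eD)[//|[a /eF aa [ba ac]]].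
exact: joined_trans ba (joined_trans aa ac).
Qed.

Definition spanning F := [forall b in halves D, forall c in halves D, joined D F b c].

Lemma spanningP F :
  reflect {in halves D &, forall b c, joined D F b c} (spanning F).
Proof.
apply: (iffP forall_inP) => [H b c bD cD|H b bD]; first exact: (forall_inP (H b bD)).
by apply/forall_inP=> c; apply: H.
Qed.

Lemma spanningS F G : F \subset G -> spanning F -> spanning G.
Proof.
by move=> FG /spanningP H; apply/spanningP=> b c bD cD; apply: joinedS FG (H _ _ _ _).
Qed.

Lemma spanning_linked F e : e \in edges D -> spanning F -> linked F e.
Proof.
case/edgesP=> b bD -> /spanningP H; rewrite linkedE //; apply: H => //.
by rewrite s1_halves.
Qed.

Lemma spanning_del F e : e \in edges D -> linked (F :\ e) e ->
  spanning F -> spanning (F :\ e).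
Proof.
move=> eD eF /spanningP H; apply/spanningP=> b c bD cD.
apply: (joined_linked eD eF); apply: joinedS (H b c bD cD).
by rewrite -subDset.
Qed.

(** If [F] is in two parts that [e] connects, then any edge between different
    components of [F] connects them too. *)
Lemma spanning_exchange F e f : e \in edges D -> f \in edges D ->
  spanning (e |: F) -> ~~ linked F f -> spanning (f |: F).
Proof.
move=> eD fD sp nf; have := linked_exchange eD fD (spanning_linked fD sp) nf.
move=> ef; have sp' : spanning (e |: (f |: F)).
  by apply: spanningS sp; rewrite setUS // subsetUr.
apply/spanningP=> b c bD cD; apply: (joined_linked eD ef).
exact: (spanningP _ sp').
Qed.

Lemma porbit_boundary_joined F b c : c \in porbit (boundary D F) b -> joined D F b c.
Proof.
case/porbitP=> i ->; elim: i => [|i IH]; first by rewrite expg0 perm1 joined_refl.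
rewrite expgSr permM; apply: joined_trans IH _; rewrite permM.
apply: joined_trans (joined_s0 _ _); rewrite ribbon_permE; case: ifP => [|_].
  by rewrite inE => /andP[_]; apply: joined_s1.
exact: joined_refl.
Qed.

(** A boundary walk stays within a component.  Hence the ribbon of a bridge is
    glued to two different boundary curves, and merges them. *)
Lemma nf_bridge F e : e \in edges D -> e \notin F -> ~~ linked F e ->
  nf (subgraph D F) = (nf (subgraph D (e |: F))).+1.
Proof.
case/edgesP=> b bD -> bF; rewrite linkedE // => nb.
have := card_boundary_add bD bF; rewrite !nf_subgraph.
rewrite (_ : b \notin _) /=; last first.
  by apply: contra nb => /porbit_boundary_joined; rewrite joined_sym.
by rewrite addn2 addn1 => -[<-].
Qed.

Definition joined_class F b := [set c | joined D F b c].

Lemma joined_class_eq F b c :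
  (joined_class F b == joined_class F c) = joined D F b c.
Proof.
apply/eqP/idP => [e|bc].
  have : c \in joined_class F c by rewrite inE joined_refl.
  by rewrite -e inE.
apply/setP=> x; rewrite !inE; apply/idP/idP; apply: joined_trans => //.
by rewrite joined_sym.
Qed.

Lemma nk_subgraph F :
  nk (subgraph D F) = #|joined_class F @: halves D| + isolated D.
Proof.
rewrite /nk /= [isolated D + _]addnC addnA.
have tB b : (s1 D b \in sub_halves D F) = (b \in sub_halves D F) by exact: s1_sub_halves.
rewrite -(card_connect_return (s0 D) tB (sub_halvesW D F)).
congr (_ + _); apply: card_eq_in_imset => b bD; apply/setP=> c; rewrite !inE.
apply/idP/idP; last first.
  move: c; apply: joined_ind => [|x _ IH|x bx IH]; first exact: connect0.
    by apply: connect_trans IH (connect1 _); rewrite /= eqxx.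
  move=> xF; apply: connect_trans IH (connect1 _).
  by rewrite /= inE xF (joined_halves bx bD) eqxx orbT.
apply: connect_sub => x y /= /orP[/eqP->|/andP[xF /eqP->]]; first exact: joined_s0.
by apply: joined_s1; move: xF; rewrite inE => /andP[].
Qed.

End Joined.

(** * Cycles and spanning trees *)

Lemma uniq_map_finer (S : Type) (rT rT' : eqType) (f : S -> rT) (g : S -> rT')
    (p : pred S) s : {in p &, forall x y, g x = g y -> f x = f y} ->
  all p s -> uniq (map f s) -> uniq (map g s).
Proof.
move=> gf; elim: s => //= x s IH /andP[px ps] /andP[nx us].
rewrite IH // andbT; apply: contra nx.
elim: s {IH us} ps => //= y s IH /andP[py ps].
by rewrite !inE => /orP[/eqP/gf->|/(IH ps)->]; rewrite ?eqxx ?orbT.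
Qed.

Section Cycles.
Variables (T : finType) (D : ribbon_graph T).
Implicit Types (a b c x y : T) (e E V W : {set T}) (F G : {set {set T}}).

Lemma vertex_joined F b c : vertex D b = vertex D c -> joined D F b c.
Proof.
move=> e; have : c \in vertex D b by rewrite e /vertex porbit_id.
case/porbitP=> i ->; elim: i => [|i bi]; first by rewrite expg0 perm1 joined_refl.
by rewrite expgSr permM; apply: joined_trans bi (joined_s0 _ _ _).
Qed.

Lemma vertex_subgraph F : {in sub_halves D F &, forall b c,
  (vertex (subgraph D F) b == vertex (subgraph D F) c) = (vertex D b == vertex D c)}.
Proof.
by move=> b c bF cF; rewrite !eq_porbit_mem porbit_return // inE bF andbT.
Qed.

(** The rest of a cycle leads from one end of a given edge to the other. *)
Lemma cycle_linked F C : C \in cycles (subgraph D F) ->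
  [/\ C != set0, C \subset F & {in C, forall e, linked D (C :\ e) e}].
Proof.
case/imsetP=> [[c sz]]; rewrite inE => /and5P[/= c0 cB cc _ ue] ->{C}.
have -> : [set edge (subgraph D F) b | b in Bseq sz] = [set edge D b | b in c] by [].
clear sz.
have cF b : b \in c -> b \in sub_halves D F by move=> bc; apply: (allP cB).
split.
- case: c c0 {cB cc ue cF} => // b c _; apply/set0Pn; exists (edge D b).
  by apply/imsetP; exists b; rewrite // inE eqxx.
- by apply/subsetP=> _ /imsetP[b /cF bc ->]; move: bc; rewrite inE => /andP[].
move=> _ /imsetP[b bc ->]; case/rot_to: (bc) => i s es.
have {}cc : path.cycle [rel b c | vertex D (s1 D b) == vertex D c] (b :: s).
  rewrite -es rot_cycle; apply: sub_in_cycle cc => [x y xF yF|]; last exact: cB.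
  by rewrite /= vertex_subgraph //= s1_sub_halves.
have ms x : x \in b :: s -> x \in c by rewrite -es mem_rot.
have {}ue : uniq (map (edge D) (b :: s)) by rewrite -es map_rot rot_uniq.
set C := imset _ _; have sC : {in s, forall x, edge D x \in C :\ edge D b}.
  move=> x xs; rewrite !inE; case/andP: ue => bs _; apply/andP; split.
    by apply: contra bs => /eqP <-; apply: map_f.
  by apply: imset_f; apply: ms; rewrite inE xs orbT.
move: cc; rewrite /= rcons_path => /andP[ps /eqP lb].
have bD : b \in halves D by have := cF _ bc; rewrite inE => /andP[].
rewrite linkedE // joined_sym; apply: joined_trans (vertex_joined _ lb).
move: (C :\ edge D b) sC => G sC.
elim: s b {C bc es ms ue bD lb} sC ps => [|y s IH] b sC /=; first by rewrite joined_refl.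
case/andP=> /eqP xy ps; apply: joined_trans (vertex_joined _ xy) _.
have yC : edge D y \in G by apply: sC; rewrite inE eqxx.
apply: joined_trans (joined_s1 yC) _.
by apply: IH => // z zs; apply: sC; rewrite inE zs orbT.
Qed.

(** A path of vertices, rather than of half-edges, can be shortened to one that
    visits no vertex twice. *)
Definition adjacent F : rel {set T} := [rel V W |
  [exists b in sub_halves D F, (V == vertex D b) && (W == vertex D (s1 D b))]].

(** Choose a half-edge for every step.  No edge is used twice, as both half-edges
    of an edge start at vertices of the path and these are distinct.  The last
    clause allows closing the path with one more edge, to which [x] and [y]
    belong. *)
Lemma lift_path F V p : path (adjacent F) V p -> uniq (V :: p) ->
  exists bs, [/\ map (vertex D) bs = belast V p, {subset bs <= sub_halves D F},
    uniq (map (edge D) bs), {in bs, forall b, vertex D (s1 D b) \in p} &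
    forall x y, vertex D (s1 D x) = V -> last V p = vertex D y ->
      path [rel b c | vertex D (s1 D b) == vertex D c] x (rcons bs y)].
Proof.
elim: p V => [|W p IH] V /=.
  by exists [::]; split=> // x y xV Vy; rewrite /= xV Vy eqxx.
case/andP=> /exists_inP[b bF /andP[/eqP Vb /eqP Wb]] Wp /and3P[Vp Wnp up].
have [|bs [mbs bsF ubs bsp bsP]] := IH W Wp; first by rewrite /= Wnp.
exists (b :: bs); split=> /=.
- by rewrite mbs Vb.
- by move=> z; rewrite inE => /orP[/eqP->|/bsF].
- rewrite ubs andbT; apply/negP => /mapP[c cbs bc].
  have bD := subsetP (sub_halvesW _ _) _ bF.
  have : c \in edge D b by rewrite bc mem_edge.
  rewrite edgeE // !inE => /orP[]/eqP ec; move: Vp; rewrite inE negb_or.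
    case/andP=> VW Vnp; have : vertex D c \in W :: p.
      by apply: mem_belast; rewrite -mbs map_f.
    by rewrite ec -Vb inE (negPf VW) (negPf Vnp).
  by have := bsp _ cbs; rewrite ec s1K // -Vb => ->; rewrite andbF.
- move=> c; rewrite !inE => /orP[/eqP->|/bsp->]; rewrite ?Wb ?eqxx ?orbT //.
- by move=> x y -> ly; rewrite Vb eqxx; apply: bsP.
Qed.

(** A simple path in [F] between the ends of [e] is closed by [e]. *)
Lemma linked_cycle F G e : e \in edges D -> e \notin F -> F \subset G ->
  linked D F e ->
  exists2 C, C \in cycles (subgraph D (e |: G)) & (e \in C) && (C \subset e |: F).
Proof.
case/edgesP=> x xD -> eF /subsetP FG; rewrite linkedE // joined_sym => sx.
have sxD : s1 D x \in halves D by rewrite s1_halves.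
have con y : joined D F (s1 D x) y ->
    connect (adjacent F) (vertex D (s1 D x)) (vertex D y).
  move: y; apply: joined_ind => [|y _|y sy IH yF]; first exact: connect0.
    by rewrite /vertex porbit1.
  apply: connect_trans IH (connect1 _); apply/exists_inP; exists y.
    by rewrite inE yF andbT; apply: joined_halves sy _.
  by rewrite !eqxx.
case/connectP: (con x sx) => p0 /shortenP[p pp up _] lp {p0}.
have [bs [mbs bsF ubs _ /(_ x x erefl (esym lp)) cbs]] := lift_path pp up.
have xB : x \in sub_halves D (edge D x |: G) by rewrite !inE xD eqxx.
have bsB y : y \in x :: bs -> y \in sub_halves D (edge D x |: G).
  rewrite inE => /orP[/eqP->//|/bsF]; rewrite !inE => /andP[-> /FG->].
  by rewrite orbT.
have ue : uniq (map (edge D) (x :: bs)).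
  rewrite /= ubs andbT; apply: contra eF => /mapP[y /bsF + ->].
  by rewrite inE => /andP[].
have sz : size (x :: bs) <= #|T|.
  by rewrite -(card_uniqP (map_uniq ue)) max_card.
exists [set edge D b | b in x :: bs]; last first.
  apply/andP; split; first by apply: imset_f; rewrite inE eqxx.
  apply/subsetP=> _ /imsetP[y + ->]; rewrite !inE => /orP[/eqP->|/bsF].
    by rewrite eqxx.
  by rewrite inE => /andP[_ ->]; rewrite orbT.
apply/imsetP; exists (Bseq sz) => //; rewrite inE; apply/and5P; split=> //.
- by apply/allP.
- apply: (@sub_in_cycle _ (mem (sub_halves D (edge D x |: G)))) (_ :
     path.cycle [rel b c | vertex D (s1 D b) == vertex D c] _).
  + by move=> b c bB cB /=; rewrite vertex_subgraph //= s1_sub_halves.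
  + exact/allP.
  + exact: cbs.
- apply: (@uniq_map_finer _ _ _ (vertex D)
    _ (mem (sub_halves D (edge D x |: G)))).
  + by move=> b c bB cB /eqP; rewrite vertex_subgraph // => /eqP.
  + exact/allP.
  + rewrite /= mbs lp; have := up; rewrite lastI rcons_uniq.
    by case/andP=> -> /=.
Qed.

Lemma acyclicP F : F \subset edges D ->
  reflect {in F, forall e, ~~ linked D (F :\ e) e} (cycles (subgraph D F) == set0).
Proof.
move=> /subsetP FD; apply: (iffP eqP) => [c0 e eF|nF].
  apply/negP=> le; have eF' : e \notin F :\ e by rewrite !inE eqxx.
  have [C] := linked_cycle (FD _ eF) eF' (subxx _) le.
  by rewrite setD1K // c0 inE.
apply/setP=> C; rewrite [RHS]inE; apply/negP=> /cycle_linked[/set0Pn[e eC] CF lC].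
have /negP[] := nF e (subsetP CF _ eC).
by apply: linkedS (lC e eC); apply: setSD.
Qed.

End Cycles.

Section SpanningTrees.
Variables (T : finType) (D : ribbon_graph T).
Implicit Types (b c : T) (e : {set T}) (F : {set {set T}}).

(** A connected [D] with half-edges has no isolated component; without half-edges
    it is a single vertex. *)
Lemma nk_spanning F : nk D = 1 -> (nk (subgraph D F) == 1) = spanning D F.
Proof.
move=> nkD; rewrite nk_subgraph.
have [h0|[b bD]] := set_0Vmem (halves D).
  have i1 : isolated D = 1 by move: nkD; rewrite /nk h0 imset0 cards0.
  by rewrite h0 imset0 cards0 i1 eqxx; apply/esym/spanningP => b; rewrite h0 inE.
have pos (f : T -> {set T}) : 0 < #|f @: halves D|.
  by apply/card_gt0P; exists (f b); apply: imset_f.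
have -> : isolated D = 0.
  by have := pos (ribbon_component D); move: nkD; rewrite /nk; case: #|_| => // n [] /eqP;
    rewrite addn_eq0 => /andP[_ /eqP].
rewrite addn0; apply/cards1P/spanningP => [[C eC] x y xD yD|H].
  have inC z : z \in halves D -> joined_class D F z = C.
    by move=> zD; apply/set1P; rewrite -eC imset_f.
  by rewrite -joined_class_eq !inC.
exists (joined_class D F b); apply/setP=> C; rewrite inE.
apply/imsetP/eqP => [[c cD ->]|->]; last by exists b.
by apply/eqP; rewrite joined_class_eq H.
Qed.

Lemma spanning_treesP F : nk D = 1 ->
  reflect [/\ F \subset edges D, spanning D F &
             {in F, forall e, ~~ linked D (F :\ e) e}]
    (F \in spanning_trees D).
Proof.
move=> nkD; rewrite inE nk_spanning //.
apply: (iffP and3P) => [[FD sF cF]|[FD sF nF]]; split=> //.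
  exact/(acyclicP FD).
exact/(acyclicP FD).
Qed.

End SpanningTrees.

(** * Activities and the spanning tree expansion *)

Section Activities.
Variables (T : finType) (D : ribbon_graph T) (le : rel {set T}).
Hypothesis le_order : total_order_on (edges D) le.
Implicit Types (b c : T) (e f : {set T}) (F A B E : {set {set T}}).

(** An element that is above as many elements as possible. *)
Lemma exists_largest E : E \subset edges D -> E != set0 ->
  exists2 m, m \in E & {in E, forall e, le e m}.
Proof.
have [refl _ trans total] := le_order.
move=> /subsetP ED /set0Pn[e0 e0E].
case: (@arg_maxnP _ e0 (mem E) (fun m => #|[set e in E | le e m]|) e0E) => m mE max_m.
exists m => // e eE; apply/negPn/negP=> nem.
have me : le m e by have := total e m (ED _ eE) (ED _ mE); rewrite (negPf nem).
have := max_m e eE; rewrite /geq /= leqNgt => /negP[]; apply/proper_card/properP; split.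
  apply/subsetP=> f; rewrite !inE => /andP[fE fm]; rewrite fE.
  by apply: (trans m f e) => //; apply: ED.
by exists e; rewrite !inE eE ?(negPf nem) // refl // ED.
Qed.

Lemma linked_joined F E b c : {in E, forall e, linked D F e} ->
  joined D E b c -> joined D F b c.
Proof.
move=> EF; move: c; apply: joined_ind => [|x _ bx|x _ bx xE].
- exact: joined_refl.
- exact: joined_trans bx (joined_s0 _ _ _).
- apply: joined_trans bx _.
  by have /forall_inP := EF _ xE; apply; apply: mem_edge.
Qed.

Lemma in_cut F e f : f \in edges D -> (f \in cut D F e) = ~~ linked D (F :\ e) f.
Proof. by move=> fD; rewrite inE fD negb_forall_in. Qed.

Section Tree.
Variables (F A B : {set {set T}}) (e : {set T}).
Hypotheses (FD : F \subset edges D) (spF : spanning D F)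
  (nF : {in F, forall f, ~~ linked D (F :\ f) f}).
Hypotheses (AF : A \subset F) (FB : F \subset B) (BD : B \subset edges D).
Hypothesis (eD : e \in edges D).

Let le_refl f : f \in edges D -> le f f.
Proof. by case: le_order => refl _ _ _ /refl. Qed.

Let le_anti f g : f \in edges D -> g \in edges D -> le f g -> le g f -> f = g.
Proof. by case: le_order => _ anti _ _ fD gD fg gf; apply: anti; rewrite ?fg. Qed.

(** A spanning set contains every bridge of [B].  The other edges in the cut of
    [e] are not in [B], since such an edge of [B] could take the place of [e]. *)
Lemma bridge_active : e \in B -> ~~ linked D (B :\ e) e ->
    {in edges D :\: B, forall f, le e f} ->
  (e \in F) && (e \in internally_active D le F).
Proof.
move=> eB nB small.
have eF : e \in F.
  apply: contraR nB => neF; apply: (@linkedS _ _ F).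
    by rewrite subsetD1 FB.
  exact: spanning_linked.
rewrite eF inE eF /smallest in_cut // nF //=; apply/forall_inP=> f.
have [fD|] := boolP (f \in edges D); last by rewrite inE => /negPf->.
rewrite in_cut // => nf; have [->|fe] := eqVneq f e; first exact: le_refl.
apply: small; rewrite !inE fD andbT; apply: contra nB => fB.
have sp : spanning D (f |: F :\ e).
  by apply: (@spanning_exchange _ _ _ e); rewrite ?setD1K.
apply: (@linkedS _ _ (f |: F :\ e)); last exact: spanning_linked.
by rewrite subUset sub1set !inE fe fB setSD.
Qed.

(** A path in [B :\ e] between the ends of [e] has an edge in the cut of [e].
    It is not in [F], let alone in [A], so it is below [e]. *)
Lemma nonbridge_inactive : linked D (B :\ e) e ->
    {in B :\: A, forall f, le f e} ->
  e \notin internally_active D le F.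
Proof.
move=> lB large; rewrite inE; apply/negP=> /and3P[eF _ /forall_inP small].
have /exists_inP[f fB nf] : [exists f in B :\ e, ~~ linked D (F :\ e) f].
  rewrite -negb_forall_in; apply: contra (nF eF) => /forall_inP allF.
  apply/forall_inP=> b be; apply: linked_joined allF _.
  by have /forall_inP/(_ b be) := lB.
move: fB; rewrite !inE => /andP[fe fB]; have fD := subsetP BD _ fB.
have fA : f \notin A.
  by apply: contra nf => fA; rewrite linked_in // !inE fe (subsetP AF).
case/eqP: fe; apply: le_anti => //; first by apply: large; rewrite inE fA.
by apply: small; rewrite in_cut.
Qed.

(** A path in [A] between the ends of [e] gives a cycle on which [e] is smallest. *)
Lemma loop_active : e \notin A -> linked D A e -> {in A, forall f, le e f} ->
  (e \notin F) && (e \in externally_active D le F).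
Proof.
move=> eA lA small; have neF : e \notin F.
  apply/negP=> eF; have := nF eF; rewrite (linkedS _ lA) //.
  by rewrite subsetD1 AF.
rewrite neF !inE neF eD; apply/exists_inP.
have [C Ccyc /andP[eC CA]] := linked_cycle eD eA AF lA.
exists C => //; rewrite /smallest eC; apply/forall_inP=> f fC.
have := subsetP CA _ fC; rewrite !inE => /orP[/eqP->|/small//].
exact: le_refl.
Qed.

(** A cycle in [e |: F] through [e] has an edge outside of [A], which is below
    [e]. *)
Lemma nonloop_inactive : ~~ linked D A e -> {in B :\: A, forall f, le f e} ->
  e \notin externally_active D le F.
Proof.
move=> nA large; rewrite !inE; apply/negP=> /andP[/andP[eF _]].
case/exists_inP=> C /cycle_linked[_ CF lC] /andP[eC /forall_inP small].
have /subsetPn[f fC fA] : ~~ (C :\ e \subset A).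
  by apply: contra nA => CA; apply: linkedS CA (lC _ eC).
move: fC; rewrite !inE => /andP[fe fC]; case/eqP: (fe).
have fF : f \in F by have := subsetP CF _ fC; rewrite !inE (negPf fe).
apply: le_anti => //; [exact: subsetP FD _ fF| |exact: small].
by apply: large; rewrite inE fA (subsetP FB).
Qed.

End Tree.
End Activities.

Section Intervals.
Local Open Scope ring_scope.
Variables (K : finType) (R : nmodType).
Implicit Types (A B H : {set K}) (P : pred {set K}) (g : {set K} -> R).

Lemma setD1_id (A : {set K}) e : e \notin A -> A :\ e = A.
Proof.
by move=> eA; apply/setP=> f; rewrite !inE; case: eqP => // ->; rewrite (negPf eA).
Qed.

Lemma interval_split P g A B e :
  \sum_(H : {set K} | [&& P H, A \subset H & H \subset B]) g H =
  \sum_(H : {set K} | [&& P H, e |: A \subset H & H \subset B]) g H +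
  \sum_(H : {set K} | [&& P H, A \subset H & H \subset B :\ e]) g H.
Proof.
rewrite (bigID (fun H : {set K} => e \in H)) /=; congr (_ + _).
  by apply: eq_bigl => H; rewrite subUset sub1set; case: (P H); case: (e \in H);
    rewrite ?andbF ?andbT.
by apply: eq_bigl => H; rewrite subsetD1 -!andbA.
Qed.

Lemma interval_del g A B e : e \in B :\: A ->
  \sum_(H : {set K} | (A \subset H) && (H \subset B :\ e)) g H =
  \sum_(H : {set K} | (e |: A \subset H) && (H \subset B)) g (H :\ e).
Proof.
rewrite inE => /andP[eA eB].
rewrite (reindex_onto (fun H => H :\ e) (fun H => e |: H)) /=; last first.
  by move=> H /andP[_]; rewrite subsetD1 => /andP[_ eH]; rewrite setU1K.
apply: eq_bigl => H; rewrite subUset sub1set.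
have [eH|eH] := boolP (e \in H); last first.
  apply/negbTE; apply: contra eH => /andP[_ /eqP <-].
  exact: setU11.
rewrite setD1K // eqxx andbT !subsetD1 eA andbT !inE eqxx andbT /=.
by congr (_ && _); rewrite -[in RHS](setD1K eH) subUset sub1set eB.
Qed.

Lemma subsets_split g B e : e \in B ->
  \sum_(H : {set K} | H \subset B) g H =
  \sum_(H : {set K} | H \subset B :\ e) (g (e |: H) + g H).
Proof.
move=> eB; have eB0 : e \in B :\: set0 by rewrite setD0.
have sub0 C : \sum_(H : {set K} | H \subset C) g H =
    \sum_(H : {set K} | (set0 \subset H) && (H \subset C)) g H.
  by apply: eq_bigl => H; rewrite sub0set.
rewrite big_split /= !sub0 (interval_split predT _ _ _ e) /=; congr (_ + _).
transitivity (\sum_(H : {set K} | (set0 \subset H) && (H \subset B :\ e)) g (e |: H)).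
  rewrite (interval_del _ eB0); apply: eq_bigr => H /andP[].
  by rewrite subUset sub1set => /andP[eH _] _; rewrite setD1K.
by apply: eq_bigl => H; rewrite sub0set.
Qed.

End Intervals.

Section Expansion.
Local Open Scope ring_scope.
Variables (T : finType) (D : ribbon_graph T) (le : rel {set T}).
Implicit Types (b c : T) (e f : {set T}) (F A B L S H U : {set {set T}}).
Variables (R : comNzRingType) (X : R) (W : {set {set T}} -> R).
Hypothesis nkD : nk D = 1%N.
Hypothesis le_order : total_order_on (edges D) le.
Hypothesis W_bridge : forall F e, F \subset edges D -> e \in F ->
  ~~ linked D (F :\ e) e -> W (F :\ e) = (X - 1) * W F.

Let I F := internally_active D le F.
Let E F := externally_active D le F.

(** The edges of [B :\: A] are undecided, and all of them are below the decided
    ones.  Those in [A] belong to the trees, those in [L] are externally active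
    and have been chosen for the set that is added to the tree.  The induction
    decides the largest undecided edge [e].  If [e] is neither a bridge of [B]
    nor a loop over [A], then it is active for no tree of the interval, and both
    sides split according to whether [e] is chosen. *)
Lemma activity_interval_expansion A B L :
    A \subset B -> B \subset edges D -> L \subset edges D ->
    spanning D B -> {in A, forall a, ~~ linked D (A :\ a) a} ->
    {in L, forall l, linked D A l} ->
    {in B :\: A & edges D :\: (B :\: A), forall u d, le u d} ->
  \sum_(H : {set {set T}} | (A \subset H) && (H \subset B)) W (H :|: L) =
  \sum_(F : {set {set T}} | [&& F \in spanning_trees D, A \subset F & F \subset B])
     X ^+ #|I F :&: (B :\: A)| *
       \sum_(S : {set {set T}} | S \subset E F :&: (B :\: A)) W (F :|: S :|: L).
Proof.
have [n] := ubnP #|B :\: A|; elim: n A B L => // n IH A B L Un AB BD LD spB nA lL order.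
have [U0|U0] := eqVneq (B :\: A) set0.
  have {AB} eAB : A = B by apply/eqP; rewrite eqEsubset AB -setD_eq0 U0 eqxx.
  rewrite {}eAB in nA lL *.
  rewrite (big_pred1 B) => [|H]; last by rewrite /= eqEsubset andbC.
  rewrite (big_pred1 B) => [|F]; last first.
    rewrite /= -eqEsubset [in RHS]eq_sym andb_idl // => /eqP <-.
    by apply/(spanning_treesP _ nkD).
  rewrite setDv !setI0 cards0 expr0 mul1r (big_pred1 set0) ?setU0 // => S.
  by rewrite /= subset0.
have UD : B :\: A \subset edges D by apply: subset_trans BD; apply: subsetDl.
have [e eU e_max] := exists_largest le_order UD U0.
have eD := subsetP UD _ eU; have := eU; rewrite inE => /andP[eA eB].
have UA : B :\: (e |: A) = (B :\: A) :\ e by apply/setP=> f; rewrite !inE negb_or andbA.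
have UB : (B :\ e) :\: A = (B :\: A) :\ e.
  by apply/setP=> f; rewrite !inE; case: (f \in A); rewrite ?andbF.
have U'n : (#|(B :\: A) :\ e| < n)%N by move: Un; rewrite (cardsD1 e) eU.
have order' : {in (B :\: A) :\ e & edges D :\: ((B :\: A) :\ e), forall u d, le u d}.
  move=> u d; rewrite !in_setD1 => /andP[ue uU] /setDP[dD].
  rewrite in_setD1 negb_and negbK => /orP[/eqP->|dU]; first exact: e_max.
  by apply: order; rewrite // inE dU.
have eAB : e |: A \subset B by rewrite subUset sub1set eB.
have AeB : A \subset B :\ e by rewrite subsetD1 AB.
have BeD : B :\ e \subset edges D by apply: subset_trans BD; apply: subD1set.
have large : {in edges D :\: B, forall f, le e f}.
  move=> f /setDP[fD fB]; apply: order => //.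
  by rewrite !inE fD andbT negb_and fB orbT.
have small : {in A, forall f, le e f}.
  move=> f fA; apply: order => //.
  by rewrite !inE fA /= (subsetP BD) // (subsetP AB).
have inactive_card F : e \notin I F -> #|I F :&: (B :\: A)| = #|I F :&: ((B :\: A) :\ e)|.
  by move=> eI; rewrite [in RHS]setIDA setD1_id // inE (negPf eI).
have inactive_set F : e \notin E F -> E F :&: (B :\: A) = E F :&: ((B :\: A) :\ e).
  by move=> eE; rewrite [in RHS]setIDA setD1_id // inE (negPf eE).
have splitF g : \sum_(F : {set {set T}} | [&& F \in spanning_trees D, A \subset F & F \subset B]) g F =
    \sum_(F : {set {set T}} | [&& F \in spanning_trees D, e |: A \subset F & F \subset B]) g F +
    \sum_(F : {set {set T}} | [&& F \in spanning_trees D, A \subset F & F \subset B :\ e]) g F :> R.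
  exact: interval_split.
have splitH g : \sum_(H : {set {set T}} | (A \subset H) && (H \subset B)) g H =
    \sum_(H : {set {set T}} | (e |: A \subset H) && (H \subset B)) g H +
    \sum_(H : {set {set T}} | (A \subset H) && (H \subset B :\ e)) g H :> R.
  exact: (interval_split predT).
have nAe : ~~ linked D A e -> {in e |: A, forall a, ~~ linked D ((e |: A) :\ a) a}.
  move=> nlA a; rewrite in_setU1 => /orP[/eqP->|aA]; first by rewrite setU1K.
  apply: contra nlA => la; have aD : a \in edges D.
    by rewrite (subsetP BD) // (subsetP AB).
  have ae : a != e by apply: contraNneq eA => <-.
  rewrite -(setD1K aA); apply: linked_exchange (nA _ aA) => //.
  by apply: linkedS la; rewrite setDUl setSU // subD1set.
(* A loop over [A] is in no tree and always externally active, so [L] may or may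
   not receive it. *)
have [loop|nloop] := boolP (linked D A e).
  have treeN F : F \in spanning_trees D -> A \subset F ->
      (e \notin F) && (e \in E F).
    move=> /(spanning_treesP _ nkD)[_ _ nF] AF; exact: (loop_active le_order nF AF).
  have none g : \sum_(F : {set {set T}} | [&& F \in spanning_trees D,
      e |: A \subset F & F \subset B]) g F = 0 :> R.
    apply: big_pred0 => F; apply/negbTE/negP=> /and3P[Ft].
    rewrite subUset sub1set => /andP[eF AF] _.
    by have := treeN F Ft AF; rewrite eF.
  have lBe : linked D (B :\ e) e by apply: linkedS loop.
  have spBe := spanning_del eD lBe spB.
  have eL : \sum_(H : {set {set T}} | (e |: A \subset H) && (H \subset B)) W (H :|: L) =
      \sum_(H : {set {set T}} | (A \subset H) && (H \subset B :\ e)) W (H :|: (e |: L)).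
    rewrite [RHS](interval_del _ eU); apply: eq_bigr => H /andP[].
    by rewrite subUset sub1set => /andP[eH _] _; rewrite setUCA setUA setD1K.
  rewrite splitF none add0r splitH eL !IH ?UB //; last 2 first.
  - by rewrite subUset sub1set eD.
  - by move=> l; rewrite in_setU1 => /orP[/eqP->|/lL].
  rewrite -big_split; apply: eq_bigr => F /and3P[Ft AF FB] /=.
  have /andP[eF eE] := treeN F Ft AF.
  have eEU : e \in E F :&: (B :\: A) by rewrite inE eE.
  rewrite -mulrDr inactive_card; last by rewrite inE (negPf eF).
  congr (_ * _); rewrite (subsets_split _ eEU) big_split /= setIDA.
  by congr (_ + _); apply: eq_bigr => S _; rewrite setUCA !setUA [F :|: _]setUC.
have lL' : {in L, forall l, linked D (e |: A) l}.
  by move=> l /lL; apply: linkedS; apply: subsetUr.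
have [lB|bridge] := boolP (linked D (B :\ e) e).
  rewrite splitF splitH !IH ?UA ?UB //; last 2 first.
  - exact: spanning_del.
  - exact: nAe.
  have inact F : F \in spanning_trees D -> A \subset F -> F \subset B ->
      (#|I F :&: (B :\: A)| = #|I F :&: ((B :\: A) :\ e)|) *
      (E F :&: (B :\: A) = E F :&: ((B :\: A) :\ e)).
    move=> /(spanning_treesP _ nkD)[FD _ nF] AF FB; split.
      by apply: inactive_card; apply: nonbridge_inactive lB e_max.
    by apply: inactive_set; apply: nonloop_inactive nloop e_max.
  congr (_ + _); apply: eq_bigr => F /and3P[Ft AF FB].
    by move: AF; rewrite subUset => /andP[_ AF]; rewrite !inact.
  by rewrite !inact // (subset_trans FB) // subD1set.
(* A bridge of [B] is in all trees and internally active.  It is also a bridge of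
   every [H :|: L] that contains it, so the sum over sets with and without it
   yields a factor [1 + (X - 1)]. *)
have active F : F \in spanning_trees D -> F \subset B -> (e \in F) && (e \in I F).
  by move=> /(spanning_treesP _ nkD)[_ sF nF] FB; apply: bridge_active FB eD eB bridge large.
rewrite splitF [X in _ = _ + X]big_pred0 ?addr0 => [|F]; last first.
  apply/negbTE/negP=> /and3P[Ft _ FB].
  have /andP[+ _] := active F Ft (subset_trans FB (subD1set _ _)).
  by move/(subsetP FB); rewrite !inE eqxx.
have eL : e \notin L by apply: contra nloop => /lL.
rewrite splitH interval_del // -big_split.
have -> : \sum_(H : {set {set T}} | (e |: A \subset H) && (H \subset B))
      (W (H :|: L) + W (H :\ e :|: L)) =
    X * \sum_(H : {set {set T}} | (e |: A \subset H) && (H \subset B)) W (H :|: L).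
  rewrite mulr_sumr; apply: eq_bigr => H /andP[].
  rewrite subUset sub1set => /andP[eH AH] HB.
  have -> : H :\ e :|: L = (H :|: L) :\ e.
    by rewrite setDUl (setD1_id eL).
  rewrite W_bridge ?inE ?eH //; first by rewrite mulrBl mul1r addrC subrK.
    by rewrite subUset (subset_trans HB).
  apply: contra bridge => /forall_inP lH; apply/forall_inP=> b be.
  apply: linked_joined (lH b be) => f; rewrite !inE => /andP[fe /orP[fH|fL]].
    by rewrite linked_in ?inE ?fe ?(subsetP HB) // (subsetP BD) // (subsetP HB).
  exact: linkedS (lL _ fL).
rewrite IH ?UA // ?mulr_sumr; last exact: nAe.
apply: eq_bigr => F /and3P[Ft AF FB]; have /andP[eF eI] := active F Ft FB.
rewrite inactive_set; last by rewrite !inE eF.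
by rewrite [in RHS](cardsD1 e) inE eI eU -!setIDA exprS mulrA.
Qed.

Theorem spanning_tree_expansion :
  \sum_(H in powerset (edges D)) W H =
  \sum_(F in spanning_trees D)
     X ^+ #|internally_active D le F| *
       \sum_(S in powerset (externally_active D le F)) W (F :|: S).
Proof.
have sp : spanning D (edges D).
  rewrite -nk_spanning // -[X in _ == X]nkD nk_subgraph; apply/eqP.
  congr (_ + _)%N; apply: card_eq_in_imset => b bD; apply/setP=> c; rewrite !inE.
  apply/idP/idP.
    by apply: connect_sub => x y /orP[|/andP[_]] /eqP->; rewrite connect1 //= eqxx ?orbT.
  case/connectP=> p; elim: p b bD => [|x p IH] b bD /=; first by move=> _ ->; apply: joined_refl.
  case/andP=> bx xp cp; apply: (@joined_trans _ _ _ x); last first.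
    by apply: IH => //; case/orP: bx => /eqP->; rewrite ?s0_halves ?s1_halves.
  case/orP: bx => /eqP->; first exact: joined_s0.
  by apply: joined_s1; apply: imset_f.
have no_loop : {in set0, forall a, ~~ linked D (set0 :\ a) a} by move=> a; rewrite inE.
have no_link F : {in set0, forall l, linked D F l} by move=> l; rewrite inE.
have no_decided : {in edges D & edges D :\: edges D, forall u d, le u d}.
  by move=> u d _; rewrite setDv inE.
have := @activity_interval_expansion set0 (edges D) set0.
rewrite sub0set setD0 => /(_ isT (subxx _) isT sp no_loop (no_link _) no_decided) H.
transitivity (\sum_(H : {set {set T}} | (set0 \subset H) && (H \subset edges D)) W (H :|: set0)).
  by apply: eq_big => [F|F _]; rewrite ?inE ?sub0set ?setU0.
rewrite H {H}.
apply: eq_big => [F|F /and3P[_ _ FD]].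
  by rewrite sub0set; apply: andb_idr => /(spanning_treesP _ nkD)[].
rewrite (setIidPl _); last first.
  by apply/subsetP=> e; rewrite inE => /andP[/(subsetP FD)].
congr (_ * _); apply: eq_big => [S|S _]; rewrite ?setU0 // powersetE (setIidPl _) //.
by apply/subsetP=> e; rewrite inE => /andP[/setDP[]].
Qed.

End Expansion.

(** * Cohomology of the sphere *)

Section PlanarCohomology.
Local Open Scope ring_scope.
Variable T : finType.
Implicit Types (x y z : T) (Q E : {set {set T}}).

(** The function with value [u i] on the [i]-th set of [Q], where [bool] serves as
    the field with two elements. *)
Definition cochain Q (u : 'rV[bool]_#|Q|) x : bool :=
  \sum_(i < #|Q|) u 0 i * (x \in enum_val i).

(** The number modulo 2 of common points.  For the orbits of [turn] or [face] as
    [Q] and those of [flip] as [E], this is the incidence matrix of vertices or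
    faces with edges. *)
Definition incidence Q E : 'M[bool]_(#|Q|, #|E|) :=
  \matrix_(i < #|Q|, j < #|E|) \sum_(x in enum_val j) (x \in enum_val i : bool).

Lemma mul_incidence Q E (u : 'rV_#|Q|) j :
  (u *m incidence Q E) 0 j = \sum_(x in enum_val j) cochain u x.
Proof.
rewrite mxE exchange_big; apply: eq_bigr => i _.
by rewrite mxE mulr_sumr.
Qed.

Lemma mul_incidence_tr Q E (c : 'rV_#|E|) i :
  (c *m (incidence Q E)^T) 0 i = \sum_(x in enum_val i) cochain c x.
Proof.
rewrite mxE exchange_big; apply: eq_bigr => j _.
rewrite !mxE !mulr_sumr big_mkcond [RHS]big_mkcond.
apply: eq_bigr => x _.
by case: (x \in enum_val j); case: (x \in enum_val i); case: (c 0 j).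
Qed.

Section Orbits.
Variables (X : {set T}) (q : {perm T}).
Hypothesis qX : {in X, forall x, q x \in X}.
Let Q : {set {set T}} := porbit q @: X.

Lemma cochain_orbit (u : 'rV_#|Q|) x i : x \in X -> enum_val i = porbit q x ->
  cochain u x = u 0 i.
Proof.
move=> xX ei; rewrite /cochain (bigD1 i) //= ei porbit_id mulr1 big1 ?addr0 //.
move=> k ki; suff -> : (x \in enum_val k) = false by rewrite mulr0.
apply/negbTE; apply: contra ki => xk; apply/eqP/enum_val_inj; rewrite ei.
have /imsetP[y _ ek] := enum_valP k.
by move: xk; rewrite ek => /porbit_class ->.
Qed.

Lemma orbit_index x : x \in X -> exists i : 'I_#|Q|, enum_val i = porbit q x.
Proof.
move=> xX; have xQ : porbit q x \in Q by apply: imset_f.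
by exists (enum_rank_in xQ (porbit q x)); rewrite enum_rankK_in.
Qed.

Lemma cochain_porbit (u : 'rV_#|Q|) x : x \in X -> cochain u (q x) = cochain u x.
Proof.
move=> xX; have [i ei] := orbit_index xX.
by rewrite !(@cochain_orbit _ _ i) ?qX // porbit1.
Qed.

End Orbits.

Variables (X : {set T}) (t f : {perm T}).
Hypothesis tX : {in X, forall x, t x \in X}.
Hypothesis fX : {in X, forall x, f x \in X}.
Hypothesis fK : {in X, forall x, f (f x) = x}.
Hypothesis fN : {in X, forall x, f x != x}.
Hypothesis conn : {in X &, forall x y,
  connect [rel u v | (v == t u) || (v == f u)] x y}.
Hypothesis X0 : X != set0.

Let phi := (f * t^-1)%g.
Let V := porbit t @: X.
Let E := porbit f @: X.
Let F := porbit phi @: X.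

Lemma porbit_flip x : x \in X -> porbit f x = [set x; f x].
Proof. by move=> xX; rewrite porbit_involution ?fK ?fN. Qed.

Lemma sum_flip (g : T -> bool) x : x \in X ->
  \sum_(y in porbit f x) g y = g x (+) g (f x).
Proof.
by move=> xX; rewrite porbit_flip // big_setU1 ?big_set1 // inE eq_sym fN.
Qed.

Lemma tVX : {in X, forall x, t^-1%g x \in X}.
Proof.
move=> x xX; rewrite (@porbit_stable _ _ _ tX _ x) //.
by rewrite -{1}(permKV t x) -eq_porbit_mem porbit1.
Qed.

(** A function in the left kernel takes equal values on the two sides of an edge,
    so by connectedness the kernel consists of constants. *)
Lemma rank_incidence (q : {perm T}) : {in X, forall x, q x \in X} ->
    (forall g : T -> bool, {in X, forall x, g (q x) = g x} ->
       {in X, forall x, g (f x) = g x} -> {in X &, forall x y, g x = g y}) ->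
  (#|porbit q @: X|.-1 <= \rank (incidence (porbit q @: X) E))%N.
Proof.
set Q := porbit q @: X => qX gen; set N := incidence Q E.
have kerN : (\rank (kermx N) <= 1)%N.
  apply: leq_trans (rank_leq_row (const_mx 1 : 'rV[bool]_#|Q|)).
  apply: mxrankS; apply/row_subP => i; set u := row i _.
  have uN : u *m N = 0 by rewrite -row_mul mulmx_ker row0.
  have const : {in X &, forall x y, cochain u x = cochain u y}.
    apply: gen => x xX; first exact: cochain_porbit.
    have [j ej] := orbit_index f xX.
    have := congr1 (fun M : 'rV_#|E| => M 0 j) uN.
    rewrite mul_incidence ej sum_flip // mxE => /eqP.
    by rewrite -[_ == 0]/(_ == false) eqbF_neg negb_add eq_sym => /eqP.
  have [x0 x0X] := set0Pn _ X0.
  apply/sub_rVP; exists (cochain u x0); apply/rowP => k; rewrite [RHS]mxE [const_mx _ _ _]mxE mulr1.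
  have /imsetP[y yX ek] := enum_valP k.
  by rewrite -(const y) // (cochain_orbit _ yX ek).
by move: kerN; rewrite mxrank_ker -subn1 !leq_subLR addnC.
Qed.

Lemma connected_gen (g : T -> bool) : {in X, forall x, g (t x) = g x} ->
  {in X, forall x, g (f x) = g x} -> {in X &, forall x y, g x = g y}.
Proof.
move=> gt gf x y xX yX; case/connectP: (conn xX yX) => p + ->.
elim: p x xX => //= z p IH x xX /andP[xz /IH <- //].
  by case/orP: xz => /eqP->; rewrite ?gt ?gf.
by case/orP: xz => /eqP->; rewrite ?tX ?fX.
Qed.

Lemma phiX : {in X, forall x, phi x \in X}.
Proof. by move=> x xX; rewrite permM tVX ?fX. Qed.

Lemma connected_gen_face (g : T -> bool) : {in X, forall x, g (phi x) = g x} ->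
  {in X, forall x, g (f x) = g x} -> {in X &, forall x y, g x = g y}.
Proof.
move=> gp gf; apply: connected_gen => // x xX.
by rewrite -gf ?tX // -gp ?fX ?tX // permM fK ?tX // permK.
Qed.

Hypothesis euler : (#|V| + #|F| = #|E| + 2)%N.

(** The first cohomology group of the sphere modulo 2 vanishes.
    Coboundaries of faces have even degree at every vertex, and
    [rank_incidence] bounds their dimension from below by [#|F| - 1], and that
    of all edge sets of even degree from above by [#|E| - (#|V| - 1)].  By
    Euler's formula these numbers are equal. *)
Lemma planar_coboundary (c : T -> bool) :
    {in X, forall x, c (f x) = c x} ->
    {in X, forall x, \sum_(y in porbit t x) c y = 0} ->
  exists g : T -> bool, {in X, forall x, g (phi x) = g x} /\
                        {in X, forall x, g x (+) g (f x) = c x}.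
Proof.
move=> cf ct; set NV := incidence V E; set NF := incidence F E.
have NFV : NF *m NV^T = 0.
  apply/row_matrixP => k; rewrite row0 row_mul; apply/rowP => i.
  rewrite mul_incidence_tr mxE rowE; set w := delta_mx 0 k.
  have /imsetP[x0 x0X ->] := enum_valP i.
  have wE x : x \in X -> cochain (w *m NF) x = cochain w x + cochain w (t^-1%g x).
    move=> xX; have [j ej] := orbit_index f xX.
    rewrite (cochain_orbit _ xX ej) mul_incidence ej sum_flip //; congr (_ (+) _).
    by rewrite -(cochain_porbit phiX) ?fX // permM fK.
  have vX x : x \in porbit t x0 -> x \in X by move/(porbit_stable tX) <-.
  rewrite (eq_bigr _ (fun x xv => wE x (vX x xv))) big_split /=.
  rewrite [X in _ + X](reindex_inj (@perm_inj _ t)) /=.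
  rewrite [X in _ + X](eq_big (mem (porbit t x0)) (cochain w)); first exact: addbb.
    by move=> x; rewrite /= -!eq_porbit_mem porbit1.
  by move=> x _; rewrite permK.
have rV := rank_incidence tX connected_gen.
have rF := rank_incidence phiX connected_gen_face.
have ker_le : (kermx NV^T <= NF)%MS.
  have le : (NF <= kermx NV^T)%MS by apply/sub_kermxP.
  rewrite -(mxrank_leqif_sup le) eqn_leq mxrankS //= mxrank_ker mxrank_tr.
  rewrite leq_subLR; apply: leq_trans (leq_add rV rF).
  have [x0 x0X] := set0Pn _ X0.
  have pos (q : {perm T}) : (0 < #|porbit q @: X|)%N.
    by apply/card_gt0P; exists (porbit q x0); apply: imset_f.
  by rewrite -(leq_add2r 2) -euler -(prednK (pos t)) -(prednK (pos phi)) addSn addnS addn2.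
pose cr : 'rV[bool]_#|E| := \row_j [exists x in (enum_val j : {set T}), c x].
have crE x : x \in X -> cochain cr x = c x.
  move=> xX; have [j ej] := orbit_index f xX.
  rewrite (cochain_orbit _ xX ej) mxE ej; apply/exists_inP/idP => [[y]|cx].
    by rewrite porbit_flip // !inE => /orP[]/eqP-> //; rewrite cf.
  by exists x; rewrite // porbit_id.
have : (cr <= NF)%MS.
  apply: submx_trans ker_le; apply/sub_kermxP/rowP => i.
  rewrite mul_incidence_tr mxE; have /imsetP[x xX ->] := enum_valP i.
  rewrite -[RHS](ct x xX); apply: eq_bigr => y xy; apply: crE.
  by rewrite -(porbit_stable tX xy).
case/submxP => u eu; exists (cochain u); split=> x xX.
  exact: (cochain_porbit phiX).
have [j ej] := orbit_index f xX.
by rewrite -sum_flip // -crE // (cochain_orbit _ xX ej) eu mul_incidence ej.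
Qed.

End PlanarCohomology.

(** * Orientation of the circles *)

Section Circles.
Variables (T : finType) (P : diagram T).
Implicit Types (x y z : T) (C : {set T}).

Let tau := join true P.

Lemma flipK x : x \in darts P -> flip P (flip P x) = x.
Proof. by have [_ + _ _ _] := diagramP P; apply. Qed.

Lemma flip_neq x : x \in darts P -> flip P x != x.
Proof. by have [_ _ + _ _] := diagramP P; apply. Qed.

Lemma turn_ordinaryK x : x \in darts P -> ~~ crossing P x -> turn P (turn P x) = x.
Proof.
move=> xD; rewrite /crossing xD /= => nx; apply: porbit2K.
by have [_ _ _ /(_ x xD)[//|/eqP]] := diagramP P; rewrite (negPf nx).
Qed.

Lemma join_over x : crossing P x -> x \in Defs.over P -> tau x = (turn P)^-1%g x.
Proof. by move=> cx ox; rewrite permE /join_fun cx ox. Qed.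

Lemma join_under x : crossing P x -> x \notin Defs.over P -> tau x = turn P x.
Proof. by move=> cx ox; rewrite permE /join_fun cx (negPf ox). Qed.

Lemma join_ordinary x : ~~ crossing P x -> tau x = turn P x.
Proof. by move=> cx; rewrite permE /join_fun (negPf cx). Qed.

Lemma mem_circle x y : x \in darts P -> (y \in circle P x) =
  (y \in darts P) && (circle P y == circle P x).
Proof.
move=> xD; apply/idP/andP => [/(circle_step xD)[-> ->] //|[_ /eqP <-]].
by rewrite inE connect0.
Qed.

Lemma circle_flip x : x \in darts P -> circle P (flip P x) = circle P x.
Proof.
by move=> xD; have [//|//] := @circle_step _ P x (flip P x) xD; rewrite inE connect1 //= eqxx.
Qed.

(** The terms at [y] and [s y] cancel. *)
Lemma sum_fixfree_involution (s : {perm T}) (A : {set T}) (c : T -> bool) :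
    {in A, forall y, s (s y) = y} -> {in A, forall y, s y != y} ->
    (forall y, (s y \in A) = (y \in A)) -> {in A, forall y, c (s y) = c y} ->
  (\sum_(y in A) c y = 0)%R.
Proof.
move=> sK sN sA cs; rewrite (bigID (fun y => enum_rank y < enum_rank (s y))) /=.
rewrite [X in (_ + X)%R](reindex_inj (@perm_inj _ s)) /=.
rewrite [X in (_ + X)%R](eq_big (fun y => (y \in A) && (enum_rank y < enum_rank (s y))) c).
- exact: addbb.
- move=> y; rewrite sA; apply: andb_id2l => yA; rewrite sK // -leqNgt ltn_neqAle.
  rewrite (_ : (_ == _ :> nat) = false) //; apply/negbTE; apply: contra (sN y yA).
  by move/eqP/val_inj/enum_rank_inj => e; rewrite -e.
- by move=> y /andP[yA _]; apply: cs; rewrite -sA.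
Qed.

Hypotheses (connP : connected_diagram P) (planarP : planar P).
Variable o : T.
Hypothesis oD : o \in darts P.

Section Jordan.
Variable z : T.
Let C := circle P z.
Hypothesis zD : z \in darts P.

(** At each vertex the darts of a circle come in pairs, matched by [tau]. *)
Lemma circle_coboundary : exists g : T -> bool,
  {in darts P, forall x, g (face P x) = g x} /\
  {in darts P, forall x, g x (+) g (flip P x) = (x \in C)}.
Proof.
apply: (@planar_coboundary _ (darts P) (turn P) (flip P)) => //.
- by move=> x; rewrite turn_darts.
- by move=> x; rewrite flip_darts.
- exact: flipK.
- exact: flip_neq.
- by case: connP => _ conn x y xD yD; have := conn x y xD yD; rewrite inE.
- by case: connP.
- by move=> x xD; rewrite !mem_circle ?flip_darts ?circle_flip.
move=> x xD; have vD y : y \in porbit (turn P) x -> y \in darts P.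
  by move/(@porbit_stable _ _ (darts P)) <- => // w; rewrite turn_darts.
apply: (@sum_fixfree_involution tau) => [y /vD yD|y /vD yD|y|y /vD yD].
- exact: joinK.
- exact: join_neq.
- exact: join_porbit.
- by rewrite !mem_circle ?join_darts ?circle_tau.
Qed.

Let off := off_circle P C.

Let offE x y : off x y = [|| y == face P x,
    [&& crossing P x, x \in Defs.over P & y == turn P (turn P x)]
  | (x \notin C) && (y == flip P x)].
Proof. by []. Qed.

Lemma off_step_sym x y : x \in darts P -> off x y ->
  (y \in darts P) && connect off y x.
Proof.
move=> xD /or3P[/eqP->|/and3P[cx ox /eqP->]|/andP[xC /eqP->]].
- rewrite permM turnV_darts flip_darts xD /=.
  have iter_face n w : connect off w (iter n (face P) w).
    elim: n => [|n IH]; first exact: connect0.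
    by apply: connect_trans IH (connect1 _); rewrite offE eqxx.
  have {2}-> : x = iter #|porbit (face P) x|.-1 (face P) (face P x).
    by rewrite -iterSr prednK ?iter_porbit // lt0n card_porbit_neq0.
  by rewrite -permM; apply: iter_face.
- rewrite !turn_darts xD connect1 // offE !crossing_turn cx !over_turn ?crossing_turn //.
  by rewrite negbK ox turn2K // eqxx orbT.
rewrite flip_darts xD connect1 // offE flipK // eqxx andbT.
by move: xC; rewrite !mem_circle ?flip_darts // circle_flip // xD => ->; rewrite !orbT.
Qed.

Lemma off_sym x y : x \in darts P -> connect off x y ->
  (y \in darts P) && connect off y x.
Proof.
move=> xD /connectP[p]; elim: p x xD => [|w p IH] x xD /=.
  by move=> _ ->; rewrite xD connect0.
case/andP=> /(off_step_sym xD)/andP[wD wx] wp e.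
have /andP[-> yw] := IH w wD wp e; exact: connect_trans yw wx.
Qed.

Lemma off_flip x : x \in darts P -> connect off (flip P x) ((turn P)^-1%g x).
Proof. by move=> xD; rewrite connect1 // offE permM flipK ?eqxx. Qed.

(** Along the strand that [tau] takes through a vertex, the region to the right of
    [x] continues as the region to the left of [tau x], since that dart points
    the other way.  For an under-strand dart the region reaches around the vertex
    through the opened corner. *)
Lemma off_tau x : x \in darts P -> connect off (flip P x) (tau x).
Proof.
move=> xD; have [cx|cx] := boolP (crossing P x); last first.
  rewrite join_ordinary // -{2}(permKV (turn P) x).
  rewrite (@turn_ordinaryK ((turn P)^-1%g x)) ?turnV_darts ?crossing_turnV //.
  exact: off_flip.
have [ox|ox] := boolP (x \in Defs.over P); first by rewrite join_over // off_flip.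
rewrite join_under //; apply: connect_trans (off_flip xD) (connect1 _).
rewrite offE crossing_turnV cx over_turnV // ox permKV eqxx orbT //.
Qed.

(** Both sides of the circle can be followed all along it, and every other dart
    is reached from one of them as the diagram is connected. *)
Lemma off_two_sides y : y \in darts P -> connect off z y || connect off (flip P z) y.
Proof.
pose R w := connect off z w || connect off (flip P z) w; rewrite -/(R y).
have trR u v : R u -> connect off u v -> R v.
  by move=> /orP[] h uv; apply/orP; [left|right]; apply: connect_trans uv.
have RC x : x \in C -> R x && R (flip P x).
  rewrite inE => /connectP[p + ->]; elim/last_ind: p => [|p w IH] /=.
    by rewrite /R !connect0 orbT.
  rewrite rcons_path last_rcons => /andP[zp lw]; have := IH zp.
  have : last z p \in darts P.
    by have [] // := @circle_step _ P z (last z p) zD; rewrite inE; apply/connectP; exists p.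
  case/orP: lw => /eqP-> lD /andP[Rl Rfl]; first by rewrite flipK // Rl Rfl.
  rewrite (trR _ _ Rfl) ?off_tau //=; apply: trR Rl _.
  have fD : flip P (tau (last z p)) \in darts P by rewrite flip_darts join_darts.
  have fl : connect off (flip P (tau (last z p))) (last z p).
    by rewrite -{2}(joinK true lD) off_tau // join_darts.
  by have /andP[] := off_sym fD fl.
have Rflip x : x \in darts P -> R x -> R (flip P x).
  move=> xD Rx; have [/RC/andP[]//|xC] := boolP (x \in C).
  by apply: trR Rx (connect1 _); rewrite offE xC eqxx !orbT.
have Rturn x : x \in darts P -> R x -> R (turn P x).
  move=> xD Rx; have tD : turn P x \in darts P by rewrite turn_darts.
  rewrite -(flipK tD) Rflip ?flip_darts //; apply: trR Rx _.
  have fD : flip P (turn P x) \in darts P by rewrite flip_darts.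
  have fl : connect off (flip P (turn P x)) x.
    by rewrite -{2}(permK (turn P) x) off_flip.
  by have /andP[] := off_sym fD fl.
case: connP => _ conn yD; have := conn z y zD yD.
rewrite inE => /connectP[p + ->] {y yD}.
have Rz : R z by rewrite /R connect0.
suff H x : x \in darts P -> R x ->
    path [rel u v | (v == turn P u) || (v == flip P u)] x p -> R (last x p).
  exact: H zD Rz.
elim: p x => //= w p IH x xD Rx /andP[xw wp].
have wD : w \in darts P by case/orP: xw => /eqP->; rewrite ?turn_darts ?flip_darts.
have Rw : R w by case/orP: xw => /eqP->; [apply: Rturn | apply: Rflip].
exact: IH wD Rw wp.
Qed.

(** The Jordan curve theorem for the circle of [z]: the values of [g] distinguish
    the two sides, and by [off_two_sides] there are no further regions. *)
Lemma inside_coboundary : exists g : T -> bool,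
  [/\ {in darts P, forall x, g (face P x) = g x},
      {in darts P, forall x, g x (+) g (flip P x) = (x \in C)} &
      {in darts P, forall x, inside P o C x = g o (+) g x}].
Proof.
have [g [g_face g_flip]] := circle_coboundary; exists g; split=> // x xD.
have g_turn y : y \in darts P -> g y = g (turn P y) (+) (turn P y \in C).
  move=> yD; have tD : turn P y \in darts P by rewrite turn_darts.
  rewrite -(g_flip _ tD) addKb -{1}(permK (turn P) y).
  rewrite -(g_face (flip P (turn P y))) ?flip_darts //.
  by rewrite permM flipK.
have g_off u v : u \in darts P -> connect off u v -> g u = g v.
  move=> uD /connectP[p]; elim: p u uD => [|w p IH] u uD /=; first by move=> _ ->.
  case/andP=> uw wp e; have /andP[wD _] := off_step_sym uD uw.
  rewrite -(IH w wD wp e); case/or3P: uw => [/eqP->|/and3P[cu ou /eqP->]|/andP[uC /eqP->]].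
  - by rewrite g_face.
  - rewrite (g_turn u) // (g_turn (turn P u)) ?turn_darts // -addbA.
    have tt : tau (turn P (turn P u)) = turn P u.
      by rewrite join_over ?permK ?over_turn ?crossing_turn ?negbK.
    have -> : (turn P u \in C) = (turn P (turn P u) \in C).
      by rewrite -{1}tt !mem_circle ?join_darts ?circle_tau ?turn_darts.
    by rewrite addbb addbF.
  - by have := g_flip u uD; rewrite (negPf uC); case: (g u); case: (g _).
rewrite /inside; have gz : g z != g (flip P z).
  have := g_flip z zD; rewrite (_ : z \in C); last by rewrite inE connect0.
  by case: (g z); case: (g _).
have side y : y \in darts P -> connect off (if g y == g z then z else flip P z) y.
  move=> yD; have := off_two_sides yD; case: eqP => gy; case/orP => // c.
    by move: gz; rewrite -gy (g_off _ _ _ c) ?eqxx ?flip_darts.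
  by case: gy; rewrite (g_off _ _ _ c).
have sideD y : (if g y == g z then z else flip P z) \in darts P.
  by case: ifP; rewrite ?flip_darts.
have -> : connect (off_circle P C) o x = (g o == g x).
  apply/idP/eqP => [|e]; first exact: g_off.
  have so := side o oD; have := side x xD; rewrite -e; apply: connect_trans.
  by have /andP[] := off_sym (sideD o) so.
by case: (g o); case: (g x).
Qed.

End Jordan.
Lemma inside_flip z x : z \in darts P -> x \in darts P ->
  inside P o (circle P z) (flip P x) =
    inside P o (circle P z) x (+) (x \in circle P z).
Proof.
move=> zD xD; have [g [_ gf gi]] := inside_coboundary zD.
by rewrite !gi ?flip_darts // -gf // -addbA addKb.
Qed.

(** The A-splicing opens the corners to the left of [x] and of the opposite dart,
    and connects them. *)
Lemma inside_over z x : z \in darts P -> crossing P x -> x \in Defs.over P ->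
  inside P o (circle P z) (turn P (turn P x)) = inside P o (circle P z) x.
Proof.
move=> zD cx ox; have xD : x \in darts P by case/andP: cx.
rewrite /inside; congr (~~ _).
have st u : crossing P u -> u \in Defs.over P ->
    off_circle P (circle P z) u (turn P (turn P u)).
  by move=> cu ou; rewrite /off_circle /= cu ou eqxx orbT.
apply/idP/idP => c; apply: connect_trans c (connect1 _); last exact: st.
rewrite -{2}(turn2K cx); apply: st; first by rewrite !crossing_turn.
by rewrite !over_turn ?crossing_turn // negbK.
Qed.

Lemma inside_tau z x : z \in darts P -> x \in darts P ->
  inside P o (circle P z) (tau x) = inside P o (circle P z) (flip P x).
Proof.
move=> zD xD; have [g [gf _ gi]] := inside_coboundary zD.
have side y : y \in darts P -> inside P o (circle P z) ((turn P)^-1%g y) =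
    inside P o (circle P z) (flip P y).
  move=> yD; rewrite !gi ?turnV_darts ?flip_darts // -(gf (flip P y)) ?flip_darts //.
  by rewrite permM flipK.
rewrite -side //; have [cx|cx] := boolP (crossing P x); last first.
  rewrite join_ordinary // -{1}(permKV (turn P) x).
  by rewrite turn_ordinaryK ?turnV_darts ?crossing_turnV.
have [ox|ox] := boolP (x \in Defs.over P); first by rewrite join_over.
rewrite join_under // -[in RHS](inside_over zD) ?crossing_turnV ?over_turnV //.
by rewrite permKV.
Qed.

Lemma inside_along z x : z \in darts P -> x \in darts P ->
  inside P o (circle P z) (along P x) = inside P o (circle P z) x.
Proof. by move=> zD xD; rewrite permM inside_tau ?flip_darts // flipK. Qed.

(** The circles around the region to the left of [x] are those that contain the
    circle of [x], and also this circle itself if [x] runs anticlockwise. *)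
Lemma oriented_parity x : x \in darts P ->
  oriented P o x = odd #|[set C in circles P | inside P o C x]|.
Proof.
move=> xD; have bx := base_circle P x; have [bD cb] := circle_step xD bx.
set N := [set C in circles P | _].
have depthE : #|N :\ circle P x| = depth P o (circle P x).
  apply: eq_card => C; rewrite !inE andbC -!andbA; apply: andb_id2l => CP.
  case/imsetP: CP => z zD ->{C}; rewrite andbC; apply: andb_id2l => zx.
  apply/idP/forall_inP => [ix y|->//]; last by rewrite inE connect0.
  rewrite inE => /connectP[p + ->]; elim: p x xD ix zx {bx bD cb N} => //= w p IH x xD ix zx.
  case/andP=> xw; have wD : w \in darts P.
    by case/orP: xw => /eqP->; rewrite ?flip_darts ?join_darts.
  have xz : (x \in circle P z) = false.
    by rewrite mem_circle // xD eq_sym; apply/negbTE.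
  apply: IH => //.
    by case/orP: xw => /eqP->; rewrite ?inside_tau // inside_flip // xz addbF.
  by case/orP: xw => /eqP->; rewrite ?circle_flip ?circle_tau.
rewrite (cardsD1 (circle P x)) depthE oddD inE imset_f //= oddb.
rewrite /oriented /base_oriented.
have along_in y : y \in porbit (along P) (base P x) ->
    inside P o (circle P x) y = inside P o (circle P x) (base P x).
  case/porbitP=> i ->; have: (along P ^+ i)%g (base P x) \in darts P /\
    inside P o (circle P x) ((along P ^+ i)%g (base P x)) =
    inside P o (circle P x) (base P x); last by case.
  elim: i => [|i [iD IH]]; first by rewrite expg0 perm1.
  by rewrite expgSr permM along_darts inside_along.
have := @circle_along _ P (base P x) x bD; rewrite cb inE connect0 => /(_ isT).
case xb: (x \in porbit _ _) => /= tb; first by rewrite (along_in x xb).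
rewrite -(along_in _ tb) inside_tau // inside_flip // mem_circle // xD eqxx.
by rewrite addbT; case: (inside _ _ _ _); case: (odd _).
Qed.

Lemma oriented_along x : x \in darts P -> oriented P o (along P x) = oriented P o x.
Proof.
move=> xD; rewrite !oriented_parity ?along_darts //; congr (odd #|pred_of_set _|).
apply/setP=> C; rewrite !inE; apply: andb_id2l => /imsetP[z zD ->].
exact: inside_along.
Qed.

Lemma oriented_flip x : x \in darts P -> oriented P o (flip P x) = ~~ oriented P o x.
Proof.
by move=> xD; rewrite -(oriented_along xD) permM oriented_tau ?flip_darts // negbK.
Qed.

(** By [inside_over] and [oriented_parity] for over-strands, and by passing to
    [tau x] for under-strands.  It says that the two arcs of an A-spliced crossing
    are traversed in opposite directions, so that the surface on which the
    ribbon graph is drawn is glued from ribbons without twists. *)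
Lemma oriented_opposite x : crossing P x ->
  oriented P o (turn P (turn P x)) = oriented P o x.
Proof.
have over_case y : crossing P y -> y \in Defs.over P ->
    oriented P o (turn P (turn P y)) = oriented P o y.
  move=> cy oy; have yD : y \in darts P by case/andP: cy.
  rewrite !oriented_parity ?turn_darts //; congr (odd #|pred_of_set _|).
  apply/setP=> C; rewrite !inE; apply: andb_id2l => /imsetP[z zD ->].
  exact: inside_over.
move=> cx; have [ox|ox] := boolP (x \in Defs.over P); first exact: over_case.
have xD : x \in darts P by case/andP: cx.
have ct : crossing P (tau x) by rewrite permE crossing_join.
have := over_case _ ct; rewrite over_join // ox => /(_ isT).
by rewrite turn2_tau // !oriented_tau ?turn_darts // => /negb_inj.
Qed.

End Circles.

(** * State sum of the Kauffman bracket *)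

Section States.
Variable T : finType.
Implicit Types (Q : diagram T) (S : {set {set T}}) (b : bool) (x y z : T).

(** The crossings in [S] are B-spliced, the others A-spliced. *)
Definition smooth_fun Q S x := join (porbit (turn Q) x \notin S) Q x.

Lemma smooth_fun_inj Q S : injective (smooth_fun Q S).
Proof.
move=> x y; rewrite /smooth_fun => e.
have : join (porbit (turn Q) x \notin S) Q x \in porbit (turn Q) x.
  by rewrite join_porbit porbit_id.
rewrite e join_porbit -eq_porbit_mem => /eqP eo; move: e; rewrite eo.
exact: perm_inj.
Qed.

Definition smoothing Q S : {perm T} := perm (@smooth_fun_inj Q S).

Definition state_circle Q S x :=
  [set y | connect [rel u v | (v == flip Q u) || (v == smoothing Q S u)] x y].

Definition loops Q S := #|state_circle Q S @: darts Q|.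

Definition crossings Q := [set porbit (turn Q) x | x in [set x | crossing Q x]].

Lemma state_circle_id Q S x : x \in state_circle Q S x.
Proof. by rewrite inE connect0. Qed.

Lemma state_circle_class Q S x y :
  y \in state_circle Q S x -> state_circle Q S y = state_circle Q S x.
Proof.
rewrite inE => xy; apply/setP=> z; rewrite !inE.
have sym := @connect_perm_sym _ (flip Q) (smoothing Q S) predT (fun=> erefl).
exact/esym/(same_connect sym xy).
Qed.

Lemma crossings_splice b Q x :
  crossings (splice b Q x) = crossings Q :\ porbit (turn Q) x.
Proof.
apply/setP=> C; rewrite !inE; apply/imsetP/andP => [[y]|[Cx /imsetP[y]]].
  rewrite inE crossing_splice => /andP[cy yx] ->; rewrite /= splice_turn_off //.
  by rewrite eq_porbit_mem yx; split=> //; apply: imset_f; rewrite inE.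
rewrite inE => cy eC; move: Cx; rewrite eC eq_porbit_mem => yx.
by exists y; rewrite ?inE ?crossing_splice ?cy //= splice_turn_off.
Qed.

Lemma smoothing_splice b Q x S : porbit (turn Q) x \notin S ->
  smoothing (splice b Q x) S =
  smoothing Q (if b then S else porbit (turn Q) x |: S).
Proof.
move=> xS; apply/permP=> y; rewrite !permE /smooth_fun.
have [yx|yx] := boolP (y \in porbit (turn Q) x).
  rewrite permE /join_fun crossing_splice yx andbF /= permE /splice_fun yx.
  by rewrite (porbit_class yx); case: b; rewrite ?xS // setU11.
rewrite /= splice_turn_off //.
have -> : (porbit (turn Q) y \in if b then S else porbit (turn Q) x |: S) =
    (porbit (turn Q) y \in S).
  by case: b; rewrite // inE in_set1 eq_porbit_mem (negPf yx).
have ty : splice_turn b Q x y = turn Q y by rewrite permE /splice_fun (negPf yx).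
have tVy : (splice_turn b Q x)^-1%g y = (turn Q)^-1%g y.
  apply: (@perm_inj _ (splice_turn b Q x)); rewrite permKV permE /splice_fun.
  by rewrite turnV_porbit (negPf yx) permKV.
by rewrite !permE /join_fun crossing_splice yx andbT /= ty tVy.
Qed.

Lemma loops_splice b Q x S : porbit (turn Q) x \notin S ->
  loops (splice b Q x) S = loops Q (if b then S else porbit (turn Q) x |: S).
Proof.
move=> xS; rewrite /loops; apply: card_eq_in_imset => y _.
by rewrite /state_circle smoothing_splice.
Qed.

Lemma component_class Q x y : y \in component Q x -> component Q y = component Q x.
Proof.
rewrite inE => xy; apply/setP=> z; rewrite !inE.
have sym := @connect_perm_sym _ (turn Q) (flip Q) predT (fun=> erefl).
exact/esym/(same_connect sym xy).
Qed.

Lemma crossingless_circle Q S x y : crossingless Q (component Q x) ->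
  y \in component Q x -> state_circle Q S y = component Q x.
Proof.
move=> cl yx; rewrite -(component_class yx) in cl *.
have sm u : u \in component Q y -> smoothing Q S u = turn Q u.
  move=> uy; rewrite permE /smooth_fun permE /join_fun.
  by rewrite (negPf (forall_inP cl _ uy)).
have step u w : u \in component Q y ->
    ((w == flip Q u) || (w == smoothing Q S u)) = ((w == turn Q u) || (w == flip Q u)).
  by move=> uy; rewrite sm // orbC.
apply/setP=> z; rewrite inE; apply/idP/idP => [|zy].
  case/connectP=> p + ->; elim/last_ind: p => [|p w IH] /=; first by rewrite inE connect0.
  rewrite rcons_path last_rcons => /andP[/IH yl]; rewrite /= step // => lw.
  by move: yl; rewrite !inE => yl; apply: connect_trans yl (connect1 _).
move: zy; rewrite inE => /connectP[p + ->].
elim/last_ind: p => [|p w IH]; first by rewrite connect0.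
rewrite rcons_path last_rcons => /andP[yp /= lw].
apply: connect_trans (IH yp) (connect1 _); rewrite /= step //.
by rewrite inE; apply/connectP; exists p.
Qed.

Lemma component_id Q x : x \in component Q x.
Proof. by rewrite inE connect0. Qed.

Lemma crossing_remove Q x y : crossingless Q (component Q x) ->
  crossing (remove_component Q x) y = crossing Q y.
Proof.
move=> /forall_inP cl; rewrite /crossing /= inE.
have [yx|//] := boolP (y \in component Q x).
by have := cl y yx; rewrite /crossing => /negPf->.
Qed.

Lemma smoothing_remove Q x S : crossingless Q (component Q x) ->
  smoothing (remove_component Q x) S = smoothing Q S.
Proof.
by move=> cl; apply/permP=> y; rewrite !permE /smooth_fun !permE /join_fun crossing_remove.
Qed.

Lemma crossings_remove Q x : crossingless Q (component Q x) ->
  crossings (remove_component Q x) = crossings Q.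
Proof.
move=> cl; rewrite /crossings.
have -> // : [set y | crossing (remove_component Q x) y] = [set y | crossing Q y].
by apply/setP=> y; rewrite !inE crossing_remove.
Qed.

Lemma loops_remove Q x S : x \in darts Q -> crossingless Q (component Q x) ->
  loops Q S = (loops (remove_component Q x) S).+1.
Proof.
move=> xD cl; have cx := crossingless_circle S cl (component_id Q x).
have CD : component Q x \subset darts Q.
  apply/subsetP=> y; rewrite inE => /connectP[p + ->].
  elim: p x xD {cl cx} => //= z p IH x xD /andP[xz]; apply: IH.
  by case/orP: xz => /eqP->; rewrite ?turn_darts ?flip_darts.
have sc y : state_circle (remove_component Q x) S y = state_circle Q S y.
  by rewrite /state_circle smoothing_remove.
rewrite /loops (card_eq_in_imset (g := state_circle Q S)); last by move=> y _.
rewrite -{1}(setID (darts Q) (component Q x)) imsetU (setIidPr CD).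
have -> : state_circle Q S @: component Q x = [set component Q x].
  apply/setP=> C; rewrite inE; apply/imsetP/eqP => [[y yx ->]|->].
    exact: crossingless_circle.
  by exists x; rewrite ?component_id.
rewrite cardsU1 [_ \notin _](_ : _ = true) ?add1n //; apply/imsetP=> -[y].
by rewrite inE => /andP[yx _] e; move: yx; rewrite e state_circle_id.
Qed.

Local Open Scope ring_scope.

Lemma A_neq0 : A != 0.
Proof. by rewrite tofrac_eq0 polyX_eq0. Qed.

(** This computes [delta] times the bracket, which spares subtracting 1 from the
    number of circles. *)
Definition state_sum Q : ratfun :=
  \sum_(S in powerset (crossings Q))
     A ^+ #|crossings Q| * (A ^- 2) ^+ #|S| * delta ^+ loops Q S.

Lemma state_sum_splice Q x : crossing Q x ->
  state_sum Q = A * state_sum (splice true Q x) + A^-1 * state_sum (splice false Q x).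
Proof.
move=> cx; set c := porbit (turn Q) x.
have cQ : c \in crossings Q by apply: imset_f; rewrite inE.
rewrite /state_sum; under eq_bigl => S do rewrite powersetE.
rewrite (subsets_split _ cQ) !crossings_splice !mulr_sumr -big_split /=.
rewrite (cardsD1 c (crossings Q)) cQ.
apply: eq_big => [S|S]; first by rewrite powersetE.
rewrite subsetD1 => /andP[_ cS]; rewrite addrC !loops_splice // cardsU1 cS.
rewrite add1n !exprS !mulrA; congr (_ + _); congr (_ * _ * _).
by rewrite mulrAC expr0 mulr1 invfM mulrA mulfV ?A_neq0 ?mul1r.
Qed.

Theorem kauffman_state_sum Q p : kauffman Q p -> delta * p = state_sum Q.
Proof.
elim=> {Q p} [Q x xD QC cl|Q x p xD cl _ IH|Q x p q cx _ IHp _ IHq].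
- have cr0 : crossings Q = set0.
    apply/setP=> C; rewrite inE; apply/imsetP=> -[y]; rewrite inE => cy _.
    have yC : y \in component Q x by rewrite -QC; case/andP: cy.
    by have := forall_inP cl y yC; rewrite cy.
  rewrite /state_sum cr0 powerset0 big_set1 !cards0 !expr0 !mul1r mulr1.
  rewrite (_ : loops Q set0 = 1%N) ?expr1 //; apply/eqP/cards1P.
  exists (component Q x); apply/setP=> C; rewrite inE.
  apply/imsetP/eqP => [[y yD ->]|->].
    by apply: crossingless_circle => //; rewrite -QC.
  by exists x => //; rewrite (crossingless_circle set0 cl) // component_id.
- rewrite mulrCA IH /state_sum crossings_remove // mulr_sumr.
  apply: eq_bigr => S _; by rewrite (loops_remove S xD cl) [delta ^+ _.+1]exprS mulrCA.
by rewrite (state_sum_splice cx) -IHp -IHq mulrDr !(mulrCA delta).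
Qed.

End States.

(** * The all-A ribbon graph *)

Section AllA.
Variables (T : finType) (P : diagram T) (o : T).
Hypotheses (connP : connected_diagram P) (planarP : planar P).
Hypothesis oD : o \in darts P.
Implicit Types (x y z : T) (C K : {set T}) (S F : {set {set T}}).

Let D := all_A_ribbon_graph P o.
Let tau := join true P.
Let oriented_darts := [set x | (x \in darts P) && oriented P o x].

Lemma arcs_oriented : arcs P o \subset oriented_darts.
Proof. by apply/subsetP=> x; rewrite !inE => /andP[/andP[-> _] ->]. Qed.

(** The positively oriented darts alternate around a crossing. *)
Lemma oriented_turn x : crossing P x -> oriented P o (turn P x) = ~~ oriented P o x.
Proof.
move=> cx; have xD : x \in darts P by case/andP: cx.
have [ox|ox] := boolP (x \in Defs.over P); last first.
  by rewrite -(join_under cx ox) oriented_tau.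
rewrite -oriented_tau // -(@oriented_opposite _ P connP planarP o oD (join true P x)).
  by rewrite (join_over cx ox) permKV.
by rewrite permE crossing_join.
Qed.

Lemma oriented_turnV x : crossing P x ->
  oriented P o ((turn P)^-1%g x) = ~~ oriented P o x.
Proof.
move=> cx; have := @oriented_turn ((turn P)^-1%g x).
by rewrite crossing_turnV permKV => /(_ cx) ->; rewrite negbK.
Qed.

Lemma oriented_join b x : x \in darts P -> oriented P o (join b P x) = ~~ oriented P o x.
Proof.
move=> xD; have [cx|cx] := boolP (crossing P x).
  by rewrite permE /join_fun; case: ifP => _; rewrite ?oriented_turn ?oriented_turnV.
rewrite -(oriented_tau o xD); congr (oriented _ _ _).
by rewrite !permE /join_fun (negPf cx).
Qed.

Lemma opposite_arcE x : x \in arcs P o -> opposite_arc P o x = turn P (turn P x).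
Proof.
move=> xa; rewrite permE /opposite_arc_fun xa; move: xa; rewrite inE => /andP[cx ox].
by rewrite (oriented_opposite connP planarP oD) ?ox.
Qed.

Lemma crossing_porbit x y : y \in porbit (turn P) x -> crossing P y = crossing P x.
Proof.
case/porbitP=> i ->; elim: i => [|i IH]; first by rewrite expg0 perm1.
by rewrite expgSr permM crossing_turn.
Qed.

Lemma edge_arcs x : x \in arcs P o -> edge D x = porbit (turn P) x :&: arcs P o.
Proof.
move=> xa; have [cx ox] : crossing P x /\ oriented P o x.
  by move: xa; rewrite inE => /andP[].
rewrite edgeE //= opposite_arcE //; apply/setP=> y; rewrite in_set2 in_setI.
have tt z : turn P (turn P z) \in porbit (turn P) z.
  by rewrite -eq_porbit_mem !porbit1.
apply/idP/andP => [/orP[]/eqP->|[/porbitP[i ->]]].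
- by rewrite porbit_id.
- by rewrite tt inE !crossing_turn cx (oriented_opposite connP planarP oD).
have orb j : crossing P ((turn P ^+ j)%g x) by rewrite (crossing_porbit (mem_porbit _ _ _)).
have ori j : oriented P o ((turn P ^+ j)%g x) = ~~ odd j.
  elim: j => [|j IH]; first by rewrite expg0 perm1 ox.
  by rewrite expgSr permM oriented_turn // IH.
have even j : (turn P ^+ j.*2)%g x = x \/ (turn P ^+ j.*2)%g x = turn P (turn P x).
  elim: j => [|j [IH|IH]]; first by left; rewrite expg0 perm1.
    by right; rewrite doubleS !expgSr !permM IH.
  by left; rewrite doubleS !expgSr !permM IH turn2K.
rewrite inE orb ori /= => /even_halfK <-.
by case: (even i./2) => ->; rewrite eqxx ?orbT.
Qed.

(** The two directed arcs at a crossing. *)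
Definition crossing_edge K := K :&: arcs P o.

Lemma crossing_arc x : crossing P x -> exists2 y, y \in arcs P o & y \in porbit (turn P) x.
Proof.
move=> cx; have [ox|ox] := boolP (oriented P o x).
  by exists x; rewrite ?inE ?cx // porbit_id.
exists (turn P x); first by rewrite inE crossing_turn cx oriented_turn.
by rewrite -eq_porbit_mem porbit1.
Qed.

Lemma edges_all_A : edges D = crossing_edge @: crossings P.
Proof.
apply/setP=> e; apply/imsetP/imsetP => [[x xa ->]|[K /imsetP[x]]].
  exists (porbit (turn P) x); last exact: edge_arcs.
  by apply: imset_f; move: xa; rewrite !inE => /andP[].
rewrite inE => /crossing_arc[y ya yx] -> ->; exists y => //.
by rewrite edge_arcs // (porbit_class yx).
Qed.

Lemma crossing_edge_inj : {in crossings P &, injective crossing_edge}.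
Proof.
move=> _ _ /imsetP[x + ->] /imsetP[y + ->]; rewrite !inE => /crossing_arc[z za zx] cy e.
have : z \in crossing_edge (porbit (turn P) x) by rewrite inE zx.
by rewrite e inE => /andP[/porbit_class <- _]; rewrite (porbit_class zx).
Qed.

Section State.
Variable S : {set {set T}}.
Let sm := smoothing P S.

Lemma smoothingE x : sm x = join (porbit (turn P) x \notin S) P x.
Proof. exact: permE. Qed.

Lemma smoothing_darts x : (sm x \in darts P) = (x \in darts P).
Proof. by rewrite smoothingE join_darts. Qed.

Lemma smoothingK x : x \in darts P -> sm (sm x) = x.
Proof.
move=> xD; rewrite smoothingE; have -> : porbit (turn P) (sm x) = porbit (turn P) x.
  by apply: porbit_class; rewrite smoothingE join_porbit porbit_id.
by rewrite smoothingE joinK.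
Qed.

Lemma oriented_smoothing x : x \in darts P -> oriented P o (sm x) = ~~ oriented P o x.
Proof. by move=> xD; rewrite smoothingE oriented_join. Qed.

Lemma state_circle_darts x y : x \in darts P -> y \in state_circle P S x -> y \in darts P.
Proof.
move=> xD; rewrite inE => /connectP[p + ->]; elim: p x xD => //= z p IH x xD /andP[xz].
by apply: IH; case/orP: xz => /eqP->; rewrite ?flip_darts ?smoothing_darts.
Qed.

(** Both [flip P] and the smoothing reverse the orientation, so the oriented
    darts of a state circle all point the same way around it. *)
Lemma state_circle_porbit x y : x \in oriented_darts -> y \in oriented_darts ->
  (y \in state_circle P S x) = (y \in porbit (flip P * sm)%g x).
Proof.
rewrite !inE => /andP[xD ox] /andP[yD oy].
have flip_sm z : z \in darts P -> sm z \in porbit (flip P * sm)%g (flip P z).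
  move=> zD; have {1}-> : sm z = (flip P * sm)%g (flip P z) by rewrite permM flipK.
  by rewrite -eq_porbit_mem porbit1.
apply/idP/idP.
  suff H z : connect [rel u v | (v == flip P u) || (v == sm u)] x z ->
      (if oriented P o z then z else flip P z) \in porbit (flip P * sm)%g x.
    by move/H; rewrite oy.
  case/connectP=> p + ->; elim/last_ind: p => [|p w IH] /=; first by rewrite ox porbit_id.
  rewrite rcons_path last_rcons => /andP[xp /=]; move/IH: (xp).
  have : last x p \in darts P.
    by apply: (@state_circle_darts x) => //; rewrite inE; apply/connectP; exists p.
  move: (last x p) => u uD ux /orP[]/eqP->.
    by rewrite oriented_flip ?flipK //; case: (oriented P o u) ux.
  rewrite oriented_smoothing //; move: ux; case: (oriented P o u) => /= ux.
    by rewrite -(porbit_class ux) porbit_sym -{1}(smoothingK uD) flip_sm ?smoothing_darts.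
  by rewrite -(porbit_class ux) flip_sm.
case/porbitP=> i ->; elim: i => [|i IH]; first by rewrite expg0 perm1 connect0.
rewrite expgSr permM permM; apply: connect_trans IH _.
by apply: (@connect_trans _ _ (flip P (((flip P * sm) ^+ i)%g x))); apply: connect1;
  rewrite /= eqxx ?orbT.
Qed.

Lemma card_state_circles (p q : pred {set T}) :
    (forall x, x \in oriented_darts ->
       p (state_circle P S x) = q (porbit (flip P * sm)%g x)) ->
  #|[set C in state_circle P S @: darts P | p C]| =
  #|[set C in porbit (flip P * sm)%g @: oriented_darts | q C]|.
Proof.
move=> pq; have sub (f : T -> {set T}) (a : pred {set T}) (B : {set T}) :
    [set C in f @: B | a C] = f @: [set x in B | a (f x)].
  apply/setP=> C; rewrite inE; apply/andP/imsetP => [[/imsetP[x xB ->] ax]|[x]].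
    by exists x; rewrite // inE xB.
  by rewrite inE => /andP[xB ax] ->; rewrite imset_f.
have -> : state_circle P S @: darts P = state_circle P S @: oriented_darts.
  apply/setP=> C; apply/imsetP/imsetP => -[x]; last first.
    by rewrite inE => /andP[xD _] ->; exists x.
  move=> xD ->; have [ox|ox] := boolP (oriented P o x).
    by exists x; rewrite // inE xD.
  exists (flip P x); first by rewrite inE flip_darts xD oriented_flip.
  by apply/esym/state_circle_class; rewrite inE connect1 //= eqxx.
rewrite !sub; have -> : [set x in oriented_darts | p (state_circle P S x)] =
    [set x in oriented_darts | q (porbit (flip P * sm)%g x)].
  by apply/setP=> x; rewrite !inE; apply: andb_id2l => xO; apply: pq; rewrite inE.
apply: card_imset_eq => x y; rewrite inE => /andP[xO _]; rewrite inE => /andP[yO _].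
rewrite eq_porbit_mem -state_circle_porbit //; apply/eqP/idP => [<-|].
  exact: state_circle_id.
exact: state_circle_class.
Qed.

End State.

Lemma along_oriented x : x \in oriented_darts -> along P x \in oriented_darts.
Proof.
by rewrite !inE along_darts => /andP[xD ox]; rewrite xD (oriented_along connP planarP oD).
Qed.

Lemma smoothing0 : smoothing P set0 = tau.
Proof. by apply/permP=> x; rewrite permE /smooth_fun inE. Qed.

(** For the empty state this identifies circles with orbits of [along P]. *)
Lemma isolated_all_A : isolated D =
  #|[set C in porbit (along P) @: oriented_darts | [disjoint C & arcs P o]]|.
Proof.
have circleE x : circle P x = state_circle P set0 x.
  by rewrite /state_circle smoothing0.
rewrite /= /circles (eq_imset _ circleE) (@card_state_circles set0 _
  (fun C => [disjoint C & arcs P o])) smoothing0 // => x xO.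
have xD : x \in darts P by move: xO; rewrite inE => /andP[].
apply/forall_inP/idP => [nc|d y yx].
  apply/pred0P=> y /=; apply/negbTE/negP=> /andP[yx ya].
  have yO := subsetP arcs_oriented _ ya.
  have := nc y; rewrite state_circle_porbit // smoothing0 => /(_ yx).
  by move: ya; rewrite inE => /andP[->].
have yD := state_circle_darts xD yx.
apply/negP=> cy; have [oy|oy] := boolP (oriented P o y).
  have ya : y \in arcs P o by rewrite inE cy.
  have yO := subsetP arcs_oriented _ ya.
  move: yx; rewrite state_circle_porbit // smoothing0.
  by move/(disjointFr d); rewrite ya.
have ta : tau y \in arcs P o.
  by rewrite inE oriented_tau // oy permE crossing_join cy.
have : tau y \in state_circle P set0 x.
  rewrite -(state_circle_class yx) inE connect1 //= smoothing0 eqxx orbT //.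
have tO := subsetP arcs_oriented _ ta.
rewrite state_circle_porbit // smoothing0.
by move/(disjointFr d); rewrite ta.
Qed.

(** B-splicing a crossing amounts to A-splicing it and then passing to the
    opposite strand.  So the walk along the state circles is the walk [along P]
    with the ribbons of [S] inserted, a boundary walk of the ribbon surface. *)
Lemma loops_subgraph S : S \subset crossings P ->
  loops P S = nf (subgraph D (crossing_edge @: S)).
Proof.
move=> Scr; set F := crossing_edge @: S.
have all_sets (Q : {set {set T}}) : #|Q| = #|[set C in Q | predT C]|.
  by apply: eq_card => C; rewrite inE andbT.
rewrite /loops all_sets (card_state_circles (q := predT)) // -all_sets.
have half x : x \in arcs P o -> (x \in sub_halves D F) = (porbit (turn P) x \in S).
  move=> xa; rewrite inE xa edge_arcs // -/(crossing_edge _).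
  have cx : porbit (turn P) x \in crossings P.
    by apply: imset_f; move: xa; rewrite !inE => /andP[].
  apply/imsetP/idP => [[K KS e]|xS]; last by exists (porbit (turn P) x).
  by rewrite (crossing_edge_inj cx (subsetP Scr _ KS) e).
have -> : #|porbit (flip P * smoothing P S)%g @: oriented_darts| =
    #|porbit (along P * ribbon_perm D F)%g @: oriented_darts|.
  apply: card_eq_in_imset => x xO; apply/esym/porbit_eq_on => y yx.
  have {yx} yO : y \in oriented_darts.
    rewrite -(porbit_stable _ yx) // => u; rewrite !inE => /andP[uD ou].
    by rewrite permM smoothing_darts flip_darts uD oriented_smoothing ?flip_darts
      // oriented_flip // negbK.
  rewrite !permM ribbon_permE permE /smooth_fun -/tau; set z := flip P y.
  have zt : tau z = along P y by rewrite permM.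
  have /andP[aD oa] : (along P y \in darts P) && oriented P o (along P y).
    by have := along_oriented yO; rewrite inE.
  have [cz|cz] := boolP (crossing P z); last first.
    have nz : tau z \notin arcs P o by rewrite inE permE crossing_join (negPf cz).
    rewrite ifF; last by apply/negbTE; rewrite inE negb_and nz.
    by rewrite !permE /join_fun (negPf cz).
  have ta : tau z \in arcs P o by rewrite inE zt oa andbT -zt permE crossing_join.
  rewrite half // (porbit_class (_ : tau z \in porbit (turn P) z)); last first.
    by rewrite join_porbit porbit_id.
  case zS: (porbit (turn P) z \in S) => //=; rewrite opposite_arcE //.
  have [oz|oz] := boolP (z \in Defs.over P).
    by rewrite (join_over cz oz) permKV permE /join_fun cz oz.
  rewrite (join_under cz oz) permE /join_fun cz (negPf oz) /=.
  by rewrite -{1}(turn2K cz) permK.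
rewrite card_porbitM_sym; last by move=> x; apply: along_oriented.
rewrite (@card_porbit_return _ (along P) _ (arcs P o)) ?arcs_oriented //.
- by rewrite nf_subgraph isolated_all_A.
- by move=> x xa; rewrite ribbon_permE; case: ifP; rewrite // (s1_halves D).
- by move=> x xa; rewrite ribbon_permE inE (negPf xa).
Qed.

Let step := [rel u v | (v == along P u) || (u \in arcs P o) && (v == opposite_arc P o u)].

Let step_sym : connect_sym step.
Proof.
apply: (@connect_perm_sym _ (along P) (opposite_arc P o) (mem (arcs P o))) => x.
by rewrite /= permE opposite_arc_arcs.
Qed.

(** Represent a dart that is not oriented by its reverse. *)
Lemma oriented_darts_connected : {in oriented_darts &, forall x y, connect step x y}.
Proof.
pose rep x := if oriented P o x then x else flip P x.
have rep_flip x : x \in darts P -> rep (flip P x) = rep x.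
  by move=> xD; rewrite /rep oriented_flip // if_neg flipK.
have rep_tau x : x \in darts P -> connect step (rep x) (rep (tau x)).
  move=> xD; rewrite /rep oriented_tau //; case: ifP => ox /=.
    rewrite step_sym connect1 //= permM flipK ?join_darts // joinK // eqxx //.
  by rewrite connect1 //= permM flipK ?eqxx.
have rep_opposite x : crossing P x -> oriented P o x ->
    connect step (rep x) (rep (turn P (turn P x))).
  move=> cx ox; rewrite /rep (oriented_opposite connP planarP oD) ?ox //.
  have xa : x \in arcs P o by rewrite inE cx.
  by rewrite connect1 //= xa opposite_arcE // eqxx orbT.
have rep_turn2 x : crossing P x -> connect step (rep x) (rep (turn P (turn P x))).
  move=> cx; have xD : x \in darts P by case/andP: cx.
  have [|ox] := boolP (oriented P o x); first exact: rep_opposite.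
  apply: connect_trans (rep_tau x xD) _.
  have ct : crossing P (tau x) by rewrite permE crossing_join.
  apply: connect_trans (rep_opposite _ ct _) _; first by rewrite oriented_tau.
  by rewrite turn2_tau // step_sym rep_tau ?turn_darts.
have rep_turn x : x \in darts P -> connect step (rep x) (rep (turn P x)).
  move=> xD; have [cx|cx] := boolP (crossing P x); last first.
    by rewrite -(join_ordinary cx) rep_tau.
  have [ox|ox] := boolP (x \in Defs.over P); last by rewrite -(join_under cx ox) rep_tau.
  apply: connect_trans (rep_tau x xD) _.
  rewrite -{2}(permKV (turn P) x) (join_over cx ox) rep_turn2 ?crossing_turnV //.
move=> x y; rewrite !inE => /andP[xD ox] /andP[yD oy].
have -> : x = rep x by rewrite /rep ox.
have -> : y = rep y by rewrite /rep oy.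
have [_ conn] := connP; have := conn x y xD yD; rewrite inE => /connectP[p + ->].
elim: p x xD {ox} => /= [|z p IH] x xD; first by rewrite connect0.
case/andP=> xz zp; have zD : z \in darts P.
  by case/orP: xz => /eqP->; rewrite ?turn_darts ?flip_darts.
apply: connect_trans (IH z zD zp).
by case/orP: xz => /eqP->; [apply: rep_turn | rewrite rep_flip].
Qed.

Lemma nk_all_A : nk D = 1.
Proof.
have tB x : (opposite_arc P o x \in arcs P o) = (x \in arcs P o).
  by rewrite permE opposite_arc_arcs.
rewrite /nk isolated_all_A -(card_connect_return (along P) tB arcs_oriented).
apply/eqP/cards1P; have [x xO] : exists x, x \in oriented_darts.
  have [oo|oo] := boolP (oriented P o o); first by exists o; rewrite inE oD.
  by exists (flip P o); rewrite inE flip_darts oD oriented_flip.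
exists [set y | connect step x y]; apply/setP=> C; rewrite inE.
apply/imsetP/eqP => [[y yO ->]|->]; last by exists x.
by apply/eqP; rewrite (connect_class _ _ step_sym) oriented_darts_connected.
Qed.

End AllA.

(** * The bracket as a sum over spanning trees *)

Local Open Scope ring_scope.

(** Both exponents agree by the hypotheses on [n] and [g], which are the nullity
    and the genus of a connected subgraph with [v] vertices, [h] edges and [f]
    faces. *)
Lemma expansion_weight (K : fieldType) (a d : K) (v h f : nat) (n g : int) :
    a != 0 -> d != 0 -> n = h%:Z - v%:Z + 1 -> g * 2 = 2 - v%:Z + h%:Z - f%:Z ->
  d * (a ^ (2 - 2 * v%:Z) * ((a ^- 2 * d) ^ n * (d ^- 2) ^ g)) =
    (a ^- 2) ^+ h * d ^+ f.
Proof.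
move=> a0 d0 en eg.
rewrite expfzMl !exprnN !exprnP !exprz_exp.
rewrite -{1}(expr1z d).
transitivity (a ^ (2 - 2 * v%:Z + - 2%:Z * n) * d ^ (1 + n + - 2%:Z * g)).
  rewrite !expfzDr //; ring.
congr (a ^ _ * d ^ _); lia.
Qed.

(** The weights of an edge set without and with a bridge; here
    [- a ^+ 4 - 1 = a ^+ 2 * d]. *)
Lemma bridge_weight (K : fieldType) (a : K) (h f : nat) : a != 0 ->
  let d := - a ^+ 2 - a ^- 2 in
  (a ^- 2) ^+ h * d ^+ f.+1 = (- a ^+ 4 - 1) * ((a ^- 2) ^+ h.+1 * d ^+ f).
Proof.
move=> a0 d; have e : d = (- a ^+ 4 - 1) * a ^- 2.
  by rewrite mulrBl mul1r mulNr (exprD a 2 2 : a ^+ 4 = _) mulfK // expf_neq0.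
by rewrite [d ^+ f.+1]exprS [(a ^- 2) ^+ h.+1]exprS {1}e; ring.
Qed.

Lemma genus_half (v h f : nat) : odd f = odd (v + h) ->
  ((2 * 1 - v%:Z + h%:Z - f%:Z) %/ 2)%Z * 2 = 2 - v%:Z + h%:Z - f%:Z.
Proof. lia. Qed.

(** [- A ^+ 2 * delta] is the nonzero polynomial [A ^+ 4 + 1]. *)
Lemma delta_neq0 : delta != 0.
Proof.
have A2 : A ^+ 2 != 0 by rewrite expf_neq0 ?A_neq0.
have : tofrac ('X^4 + 1%:P : {poly int}) != 0.
  by rewrite tofrac_eq0 -size_poly_eq0 size_XnaddC.
apply: contraNneq => d0.
have : A ^+ 2 * - delta = A ^+ 4 + 1 by rewrite /delta opprD !opprK mulrDr mulfV // -exprD.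
by rewrite d0 oppr0 mulr0 tofracD tofracXn tofrac1 => <-.
Qed.

Lemma big_powerset_imset (R : nmodType) (I J : finType) (h : I -> J) (X : {set I})
    (g : {set J} -> R) : {in X &, injective h} ->
  \sum_(H in powerset (h @: X)) g H = \sum_(S in powerset X) g (h @: S).
Proof.
move=> h_inj; have im_inj : {in powerset X &, injective (fun S : {set I} => h @: S)}.
  have part (S : {set I}) : S \in powerset X -> S = [set x in X | h x \in h @: S].
    rewrite powersetE => /subsetP SX; apply/setP=> x; rewrite inE.
    apply/idP/andP => [xS|[xX /imsetP[y yS e]]]; first by rewrite SX ?imset_f.
    by rewrite (h_inj x y) // SX.
  by move=> S S' SX S'X e; rewrite (part S) // e -part.
rewrite -(big_imset g im_inj); apply: eq_bigl => H.
rewrite powersetE; apply/idP/imsetP => [HX|[S + ->]]; last first.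
  by rewrite powersetE => /imsetS->.
exists [set x in X | h x \in H]; first by rewrite powersetE; apply/subsetP=> x; rewrite inE => /andP[].
apply/setP=> y; apply/idP/imsetP => [yH|[x + ->]]; last by rewrite inE => /andP[].
by have /imsetP[x xX ey] := subsetP HX y yH; exists x; rewrite // inE xX -ey.
Qed.

Theorem corollary6p1 (T : finType) (P : diagram T) (o : T) (p : ratfun)
    (le : rel {set T}) :
  connected_diagram P -> planar P -> o \in darts P -> kauffman P p ->
  total_order_on (edges (all_A_ribbon_graph P o)) le ->
  let D := all_A_ribbon_graph P o in
  let X : ratfun := - A ^+ 4 in
  let Y : ratfun := A ^- 2 * delta in
  let Z : ratfun := delta ^- 2 in
  A ^- ne D * p =
  A ^ (2 - 2 * (nv D)%:Z) *
    \sum_(F in spanning_trees D)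
      X ^+ #|internally_active D le F| *
        \sum_(S in powerset (externally_active D le F))
          Y ^ nullity (subgraph D (F :|: S)) * Z ^ genus (subgraph D (F :|: S)).
Proof.
move=> connP planarP oD Pp le_order D X Y Z.
have A0 := A_neq0; have d0 := delta_neq0.
have nkD : nk D = 1%N := nk_all_A connP planarP oD.
pose W (F : {set {set T}}) : ratfun := (A ^- 2) ^+ #|F| * delta ^+ nf (subgraph D F).
have edgesD : edges D = @crossing_edge T P o @: crossings P := edges_all_A connP planarP oD.
have inj := @crossing_edge_inj _ P o connP planarP oD.
have W_bridge (F : {set {set T}}) e : F \subset edges D -> e \in F ->
    ~~ linked D (F :\ e) e -> W (F :\ e) = (X - 1) * W F.
  move=> /subsetP FD eF ne; rewrite /W [#|F|](cardsD1 e) eF.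
  rewrite (nf_bridge (FD _ eF) _ ne) ?setD11 // setD1K //.
  exact: bridge_weight A0.
have sumW : delta * (A ^- ne D * p) = \sum_(F in powerset (edges D)) W F.
  rewrite mulrCA (kauffman_state_sum Pp) /state_sum edgesD (big_powerset_imset _ inj).
  rewrite mulr_sumr; apply: eq_bigr => S; rewrite powersetE => SP.
  rewrite (loops_subgraph connP planarP oD SP) -/D /W (card_in_imset (sub_in2 (subsetP SP) inj)).
  rewrite /ne edgesD (card_in_imset inj) -mulrA; apply: mulKf.
  exact: (expf_neq0 _ A0).
apply: (mulfI d0); rewrite sumW (spanning_tree_expansion nkD le_order W_bridge).
rewrite !mulr_sumr; apply: eq_bigr => F Ft.
rewrite [A ^ _ * _]mulrCA [RHS]mulrCA; congr (_ * _).
rewrite !mulr_sumr; apply: eq_bigr => S; rewrite powersetE => SE.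
have /(spanning_treesP _ nkD)[FD spF _] := Ft.
have FSD : F :|: S \subset edges D.
  rewrite subUset FD; apply: subset_trans SE _.
  by apply/subsetP=> e; rewrite inE => /andP[/setDP[]].
have nk1 : nk (subgraph D (F :|: S)) = 1%N.
  by apply/eqP; rewrite nk_spanning // (spanningS _ spF) // subsetUl.
have neFS : ne (subgraph D (F :|: S)) = #|F :|: S| by rewrite /ne edges_subgraph.
rewrite /W; symmetry; apply: expansion_weight => //.
  by rewrite /nullity nk1 nv_subgraph neFS.
rewrite /genus nk1 nv_subgraph neFS; apply: genus_half.
exact: odd_nf_subgraph.
Qed.
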